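(* Let $\mathbb{G}$ be a compact quantum group. Then $$\mathrm{Gauss}(\mathbb{G}) \subset \mathbb{G}^{00} \subset \mathrm{Kac}(\mathbb{G})$$ as quantum subgroups of $\mathbb{G}$; that is, the Gaussian part of $\mathbb{G}$ is contained in the strongly connected component of the identity of $\mathbb{G}$, which in turn is contained in the Kac part of $\mathbb{G}$.
   Context: A CQG-algebra is a Hopf $*$-algebra over $\mathbb{C}$ spanned by the coefficients of its finite-dimensional unitary corepresentations. A compact quantum group $\mathbb{G}$ is by definition given by a CQG-algebra, denoted $\mathcal{O}(\mathbb{G})$, with counit $\varepsilon$ and antipode $S$. A (closed) quantum subgroup $\mathbb{H}$ of $\mathbb{G}$ is given by a surjective Hopf $*$-algebra morphism $q_{\mathbb{H}}:\mathcal{O}(\mathbb{G})\to\mathcal{O}(\mathbb{H})$, equivalently by the Hopf $*$-ideal $\mathcal{I}_{\mathbb{H}}=\ker q_{\mathbb{H}}$ of $\mathcal{O}(\mathbb{G})$. For quantum subgroups $\mathbb{H}_1,\mathbb{H}_2$ of $\mathbb{G}$, $\mathbb{H}_1\subset\mathbb{H}_2$ means $\mathcal{I}_{\mathbb{H}_2}\subset\mathcal{I}_{\mathbb{H}_1}$. Put $K_1=\ker\varepsilon$, $K_n=K_1^n$ (linear span of products of $n$ elements of $\ker\varepsilon$), and $K_\infty=\bigcap_{n\ge1}K_n$; $K_\infty$ is a Hopf $*$-ideal of $\mathcal{O}(\mathbb{G})$. A generating functional is a linear functional $\phi:\mathcal{O}(\mathbb{G})\to\mathbb{C}$ with $\phi(1)=0$,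 $\phi(b^* )=\overline{\phi(b)}$ for all $b$, and $\phi(b^*b)\ge0$ for all $b\in\ker\varepsilon$. It is Gaussian if $\phi|_{K_3}=0$. The Gaussian part $\mathrm{Gauss}(\mathbb{G})$ is the quantum subgroup of $\mathbb{G}$ given by the largest Hopf $*$-ideal of $\mathcal{O}(\mathbb{G})$ contained in $\bigcap\{\ker\phi:\phi \text{ a Gaussian generating functional on }\mathcal{O}(\mathbb{G})\}$; equivalently, the smallest quantum subgroup $\mathbb{H}$ such that every Gaussian generating functional factors through $q_{\mathbb{H}}$. The strongly connected component of the identity $\mathbb{G}^{00}$ is the quantum subgroup with $\mathcal{O}(\mathbb{G}^{00})=\mathcal{O}(\mathbb{G})/K_\infty$. A compact quantum group is of Kac type if its antipode satisfies $S^2=\mathrm{id}$. The Kac part $\mathrm{Kac}(\mathbb{G})$ is the largest quantum subgroup of $\mathbb{G}$ which is of Kac type. *)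

(* Defs.v *)
From HB Require Import structures.
From mathcomp Require Import all_boot all_order all_algebra.
From mathcomp Require Import generic_quotient sesquilinear.
From mathcomp Require Import boolp classical_sets reals complex.

Set Implicit Arguments.
Unset Strict Implicit.
Unset Printing Implicit Defensive.

Import Order.TTheory GRing.Theory Num.Theory.
Local Open Scope classical_set_scope.
Local Open Scope quotient_scope.
Local Open Scope ring_scope.

Definition linear_span (K : fieldType) (V : lmodType K) (X : set V) : set V :=
  [set v | exists s : seq (K * V),
     (forall p, p \in s -> X p.2) /\ v = \sum_(p <- s) p.1 *: p.2].

(* An element of U ⊗ V is a class of finite formal sums of pairs; two formal
    sums are identified when no bilinear map distinguishes them. *)
Section TensorType.
Variables (K : fieldType) (U V : lmodType K).
Implicit Types s r : seq (U * V).

Definition eval_formal (W : lmodType K) (b : U -> V -> W) s : W :=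
  \sum_(p <- s) b p.1 p.2.

Definition tensor_equiv s r : bool :=
  `[< forall (W : lmodType K) (b : U -> V -> W),
        bilinear_for *:%R *:%R b -> eval_formal b s = eval_formal b r >].

Lemma tensor_equiv_is_equiv : equiv_class_of tensor_equiv.
Proof.
split=> [s|s t|t s u].
- exact/asboolP.
- by apply/asboolP/asboolP => h W b hb; rewrite h.
- move=> /asboolP h1 /asboolP h2; apply/asboolP => W b hb.
  by rewrite h1 // h2.
Qed.

Canonical tensor_equiv_rel := EquivRelPack tensor_equiv_is_equiv.

Definition tensor := {eq_quot tensor_equiv_rel}.
HB.instance Definition _ := Choice.on tensor.
HB.instance Definition _ := EqQuotient.on tensor.

Definition tclass s : tensor := \pi_tensor s.
Definition tpure (x : U) (y : V) : tensor := tclass [:: (x, y)].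

(* The linear map on U ⊗ V induced by b.  It is meaningful when b is bilinear
   (or additive and conjugate-linear in each variable): the value then does not
   depend on the representative. *)
Definition tlift (W : lmodType K) (b : U -> V -> W) (t : tensor) : W :=
  eval_formal b (repr t).

Lemma tclass_eqP s r :
  (forall (W : lmodType K) (b : U -> V -> W),
     bilinear_for *:%R *:%R b -> eval_formal b s = eval_formal b r) <->
  tclass s = tclass r.
Proof.
rewrite /tclass; split=> [h|/eqmodP /asboolP //].
by apply/eqmodP/asboolP.
Qed.

Lemma tlift_class (W : lmodType K) (b : U -> V -> W) s :
  bilinear_for *:%R *:%R b -> tlift b (tclass s) = eval_formal b s.
Proof.
move=> hb; rewrite /tlift.
have /tclass_eqP : tclass (repr (tclass s)) = tclass s by rewrite /tclass reprK.
exact.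
Qed.

Lemma tclass_repr (t : tensor) : tclass (repr t) = t.
Proof. by rewrite /tclass reprK. Qed.

Definition tzero : tensor := tclass [::].
Definition tadd (t u : tensor) : tensor := tclass (repr t ++ repr u).
Definition tscale (a : K) (t : tensor) : tensor :=
  tclass [seq (a *: p.1, p.2) | p <- repr t].
Definition topp (t : tensor) : tensor := tscale (-1) t.

Lemma eval_cat (W : lmodType K) (b : U -> V -> W) s r :
  eval_formal b (s ++ r) = eval_formal b s + eval_formal b r.
Proof. exact: big_cat. Qed.

Lemma bilinZl (W : lmodType K) (b : U -> V -> W) a x y :
  bilinear_for *:%R *:%R b -> b (a *: x) y = a *: b x y.
Proof. by case=> hl _; exact: (scalable_linear (hl y)). Qed.

Lemma eval_scale (W : lmodType K) (b : U -> V -> W) a s :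
  bilinear_for *:%R *:%R b ->
  eval_formal b [seq (a *: p.1, p.2) | p <- s] = a *: eval_formal b s.
Proof.
move=> hb; rewrite /eval_formal big_map scaler_sumr.
by apply: eq_bigr => p _; rewrite /= bilinZl.
Qed.

Lemma tensor_ext (t u : tensor) :
  (forall (W : lmodType K) (b : U -> V -> W),
     bilinear_for *:%R *:%R b -> tlift b t = tlift b u) -> t = u.
Proof. by move=> h; rewrite -(tclass_repr t) -(tclass_repr u); exact/tclass_eqP. Qed.

Section Eval.
Variables (W : lmodType K) (b : U -> V -> W).
Hypothesis hb : bilinear_for *:%R *:%R b.

Lemma tlift_zero : tlift b tzero = 0.
Proof. by rewrite tlift_class // /eval_formal big_nil. Qed.

Lemma tlift_add (t u : tensor) : tlift b (tadd t u) = tlift b t + tlift b u.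
Proof. by rewrite tlift_class // eval_cat. Qed.

Lemma tlift_scale a (t : tensor) : tlift b (tscale a t) = a *: tlift b t.
Proof. by rewrite tlift_class // eval_scale. Qed.

End Eval.

Lemma taddA : associative tadd.
Proof. by move=> t u v; apply: tensor_ext => W b hb; rewrite !tlift_add // addrA. Qed.
Lemma taddC : commutative tadd.
Proof. by move=> t u; apply: tensor_ext => W b hb; rewrite !tlift_add // addrC. Qed.
Lemma tadd0 : left_id tzero tadd.
Proof.
by move=> t; apply: tensor_ext => W b hb; rewrite tlift_add // tlift_zero // add0r.
Qed.
Lemma taddN : left_inverse tzero topp tadd.
Proof.
move=> t; apply: tensor_ext => W b hb.
by rewrite tlift_add // tlift_scale // tlift_zero // scaleN1r addNr.
Qed.

HB.instance Definition _ := GRing.isZmodule.Build tensor taddA taddC tadd0 taddN.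

Lemma tscaleA a c (t : tensor) : tscale a (tscale c t) = tscale (a * c) t.
Proof. by apply: tensor_ext => W b hb; rewrite !tlift_scale // scalerA. Qed.
Lemma tscale1 : left_id 1 tscale.
Proof. by move=> t; apply: tensor_ext => W b hb; rewrite tlift_scale // scale1r. Qed.
Lemma tscaleDr : right_distributive tscale +%R.
Proof.
move=> a t u; apply: tensor_ext => W b hb.
by rewrite tlift_scale // !tlift_add // !tlift_scale // scalerDr.
Qed.
Lemma tscaleDl (t : tensor) : {morph tscale^~ t : a c / a + c}.
Proof.
move=> a c; apply: tensor_ext => W b hb.
by rewrite tlift_add // !tlift_scale // scalerDl.
Qed.

HB.instance Definition _ := GRing.Zmodule_isLmodule.Build K tensor
  tscaleA tscale1 tscaleDr tscaleDl.

Lemma tlift_linear (W : lmodType K) (b : U -> V -> W) :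
  bilinear_for *:%R *:%R b -> linear (tlift b).
Proof. by move=> hb a t u; rewrite tlift_add // tlift_scale. Qed.

Lemma tlift_pure (W : lmodType K) (b : U -> V -> W) x y :
  bilinear_for *:%R *:%R b -> tlift b (tpure x y) = b x y.
Proof. by move=> hb; rewrite tlift_class // /eval_formal big_seq1. Qed.

Lemma tpure_bilinear : bilinear_for *:%R *:%R tpure.
Proof.
split=> [y|x] a u v; apply: tensor_ext => W b hb;
  rewrite tlift_linear // !tlift_pure //; case: hb => hl hr.
- exact: (hl y a u v).
- exact: (hr x a u v).
Qed.

End TensorType.

(* W with the scalar multiplication twisted by conjugation. *)
Section ConjugateModule.
Variables (C : numClosedFieldType) (W : lmodType C).

Definition conj_module : Type := W.
HB.instance Definition _ := GRing.Zmodule.on conj_module.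

Definition conj_scale (a : C) (w : conj_module) : conj_module :=
  (a^* : C) *: (w : W).

Lemma conj_scaleA a b w : conj_scale a (conj_scale b w) = conj_scale (a * b) w.
Proof. by rewrite /conj_scale scalerA rmorphM. Qed.
Lemma conj_scale1 : left_id 1 conj_scale.
Proof. by move=> w; rewrite /conj_scale rmorph1 scale1r. Qed.
Lemma conj_scaleDr : right_distributive conj_scale +%R.
Proof. by move=> a u v; rewrite /conj_scale scalerDr. Qed.
Lemma conj_scaleDl w : {morph conj_scale^~ w : a b / a + b}.
Proof. by move=> a b; rewrite /conj_scale rmorphD scalerDl. Qed.

HB.instance Definition _ := GRing.Zmodule_isLmodule.Build C conj_module
  conj_scaleA conj_scale1 conj_scaleDr conj_scaleDl.

End ConjugateModule.

Notation "x ⊗ y" := (tpure x y) (at level 40, left associativity) : ring_scope.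

Definition tmap (K : fieldType) (U V U' V' : lmodType K)
    (f : U -> U') (g : V -> V') : tensor U V -> tensor U' V' :=
  tlift (fun x y => f x ⊗ g y).

Definition tassoc (K : fieldType) (U V W : lmodType K) :
    tensor (tensor U V) W -> tensor U (tensor V W) :=
  tlift (fun t z => tlift (fun x y => x ⊗ (y ⊗ z)) t).

Lemma tmap_pure (K : fieldType) (U V U' V' : lmodType K)
    (f : {linear U -> U'}) (g : {linear V -> V'}) x y :
  tmap f g (x ⊗ y) = f x ⊗ g y.
Proof.
rewrite /tmap tlift_pure //; split=> [v|u] a p q; rewrite linearP.
- by rewrite (tpure_bilinear _ _).1.
- by rewrite (tpure_bilinear _ _).2.
Qed.

Lemma tassoc_pure (K : fieldType) (U V W : lmodType K)
    (x : U) (y : V) (z : W) : tassoc ((x ⊗ y) ⊗ z) = x ⊗ (y ⊗ z).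
Proof.
have h w : bilinear_for *:%R *:%R (fun (x : U) (y : V) => x ⊗ (y ⊗ w)).
  split=> [v|u] a p q; first by rewrite (tpure_bilinear _ _).1.
  by rewrite (tpure_bilinear _ _).1 (tpure_bilinear _ _).2.
rewrite /tassoc tlift_pure ?tlift_pure //; split=> [w|t] a p q.
  exact: tlift_linear.
rewrite /= /tlift /eval_formal scaler_sumr -big_split /=; apply: eq_bigr => i _.
by rewrite !(tpure_bilinear _ _).2.
Qed.

(* (a ⊗ b) (c ⊗ d) = ac ⊗ bd *)
Definition tmul (K : fieldType) (A : algType K) (s t : tensor A A) : tensor A A :=
  tlift (fun a b => tlift (fun c d => (a * c) ⊗ (b * d)) t) s.

Lemma tmul_pure (K : fieldType) (A : algType K) (a b c d : A) :
  tmul (a ⊗ b) (c ⊗ d) = (a * c) ⊗ (b * d).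
Proof.
have h (x y : A) : bilinear_for *:%R *:%R (fun z w : A => (x * z) ⊗ (y * w)).
  split=> [w|z] k p q; rewrite mulrDr -scalerAr.
  - by rewrite (tpure_bilinear _ _).1.
  - by rewrite (tpure_bilinear _ _).2.
rewrite /tmul tlift_pure ?tlift_pure //; split=> [w|z] k p q;
  rewrite /= /tlift /eval_formal scaler_sumr -big_split /=; apply: eq_bigr => i _;
  rewrite mulrDl -scalerAl.
- by rewrite (tpure_bilinear _ _).1.
- by rewrite (tpure_bilinear _ _).2.
Qed.

HB.mixin Record isStarAlgebra (C : numClosedFieldType) A
    of GRing.Algebra C A := {
  star : A -> A;
  starK : involutive star;
  star_conjlinear : forall (a : C) (x y : A),
    star (a *: x + y) = a^* *: star x + star y;
  starM : forall x y : A, star (x * y) = star y * star x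
}.

#[short(type="starAlgType")]
HB.structure Definition StarAlgebra (C : numClosedFieldType) :=
  { A of isStarAlgebra C A & GRing.Algebra C A }.

(* (a ⊗ b)^* = a^* ⊗ b^* *)
Definition tstar (C : numClosedFieldType) (A : starAlgType C) :
    tensor A A -> tensor A A :=
  tlift (fun a b => star a ⊗ star b).

Lemma tstar_pure (C : numClosedFieldType) (A : starAlgType C) (a b : A) :
  tstar (a ⊗ b) = star a ⊗ star b.
Proof.
pose B (x y : A) : conj_module (tensor A A) := star x ⊗ star y.
have hB : bilinear_for *:%R *:%R B.
  split=> [w|z] k p q; rewrite /B star_conjlinear.
  - by rewrite (tpure_bilinear _ _).1.
  - by rewrite (tpure_bilinear _ _).2.
exact: (tlift_pure a b hB).
Qed.

HB.mixin Record isHopfStarAlgebra (C : numClosedFieldType) A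
    of StarAlgebra C A := {
  comul : {linear A -> tensor A A};
  counit : {lrmorphism A -> C^o};
  antipode : {linear A -> A};
  comul1 : comul 1 = 1 ⊗ 1;
  comulM : forall a b : A, comul (a * b) = tmul (comul a) (comul b);
  comul_star : forall a : A, comul (star a) = tstar (comul a);
  comulA : forall a : A,
    tassoc (tmap comul idfun (comul a)) = tmap idfun comul (comul a);
  counitl : forall a : A, tlift (fun x y => counit x *: y) (comul a) = a;
  counitr : forall a : A, tlift (fun x y => counit y *: x) (comul a) = a;
  antipodel : forall a : A,
    tlift (fun x y => antipode x * y) (comul a) = (counit a : C)%:A;
  antipoder : forall a : A,
    tlift (fun x y => x * antipode y) (comul a) = (counit a : C)%:A
}.

#[short(type="hopfStarAlgType")]
HB.structure Definition HopfStarAlgebra (C : numClosedFieldType) :=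
  { A of isHopfStarAlgebra C A & StarAlgebra C A }.

Section Corepresentations.
Variables (C : numClosedFieldType) (A : hopfStarAlgType C).

Definition adjoint_mx n (u : 'M[A]_n) : 'M[A]_n := \matrix_(i, j) star (u j i).

Definition corepresentation n (u : 'M[A]_n) : Prop :=
  forall i j, comul (u i j) = \sum_(k < n) u i k ⊗ u k j /\
              counit (u i j) = (i == j)%:R.

Definition unitary_corepresentation n (u : 'M[A]_n) : Prop :=
  [/\ corepresentation u, u *m adjoint_mx u = 1%:M & adjoint_mx u *m u = 1%:M].

Definition unitary_coefficients : set A :=
  [set a | exists n (u : 'M[A]_n) i j, unitary_corepresentation u /\ a = u i j].

End Corepresentations.

HB.mixin Record isCQGAlgebra (C : numClosedFieldType) A
    of HopfStarAlgebra C A := {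
  cqg_span : forall a : A, linear_span (@unitary_coefficients C A) a
}.

#[short(type="cqgAlgType")]
HB.structure Definition CQGAlgebra (C : numClosedFieldType) :=
  { A of isCQGAlgebra C A & HopfStarAlgebra C A }.

Section QuantumSubgroups.
Variables (C : numClosedFieldType) (A : cqgAlgType C).

Record two_sided_ideal (I : set A) : Prop := {
  tsi_zero : I 0;
  tsi_linear : forall (c : C) x y, I x -> I y -> I (c *: x + y);
  tsi_mull : forall a x, I x -> I (a * x);
  tsi_mulr : forall a x, I x -> I (x * a)
}.

(* I ⊗ A + A ⊗ I *)
Definition tensor_ideal (I : set A) : set (tensor A A) :=
  linear_span [set t | exists x y, (I x \/ I y) /\ t = x ⊗ y].

Record hopf_star_ideal (I : set A) : Prop := {
  hsi_ideal : two_sided_ideal I;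
  hsi_star : forall x, I x -> I (star x);
  hsi_comul : forall x, I x -> tensor_ideal I (comul x);
  hsi_counit : forall x, I x -> counit x = 0;
  hsi_antipode : forall x, I x -> I (antipode x)
}.

(* A quantum subgroup H of G is represented by the Hopf *-ideal I_H, so that
   O(H) = A / I_H where A = O(G). *)
Record quantum_subgroup := QuantumSubgroup {
  qideal : set A;
  qidealP : hopf_star_ideal qideal
}.

HB.instance Definition _ := gen_eqMixin quantum_subgroup.
HB.instance Definition _ := gen_choiceMixin quantum_subgroup.

Definition qsubset (H1 H2 : quantum_subgroup) : Prop :=
  qideal H2 `<=` qideal H1.

Lemma zero_hopf_star_ideal : hopf_star_ideal [set 0].
Proof.
split=> [|x ->|x ->|x ->|x ->] /=.
- split=> //= [c x y -> ->|a x ->|a x ->].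
  + by rewrite scaler0 addr0.
  + by rewrite mulr0.
  + by rewrite mul0r.
- have := star_conjlinear (-1) (0 : A) 0.
  by rewrite scaler0 addr0 rmorphN1 scaleN1r addNr.
- by exists [::]; split=> //; rewrite big_nil linear0.
- by rewrite linear0.
- by rewrite linear0.
Qed.

Definition whole_group : quantum_subgroup := QuantumSubgroup zero_hopf_star_ideal.

(* The quantum subgroup characterized by P; the junk value, taken when nothing
   satisfies P, is G itself. *)
Definition the_subgroup (P : set quantum_subgroup) : quantum_subgroup :=
  xget whole_group P.

Definition is_largest_subgroup (P : set quantum_subgroup)
    (H : quantum_subgroup) : Prop :=
  P H /\ forall H', P H' -> qsubset H' H.

(* K_n for n >= 1; the value at n = 0 is not used. *)
Definition Kpow (n : nat) : set A :=
  linear_span [set a | exists s : n.-tuple A,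
    (forall i, counit (tnth s i) = 0) /\ a = \prod_(i < n) tnth s i].

Definition Kinfty : set A := [set a | forall n, (0 < n)%N -> Kpow n a].

Record generating_functional (phi : {scalar A}) : Prop := {
  gf_one : phi 1 = 0;
  gf_star : forall b, phi (star b) = (phi b)^*;
  gf_pos : forall b, counit b = 0 -> 0 <= phi (star b * b)
}.

Definition gaussian (phi : {scalar A}) : Prop :=
  generating_functional phi /\ forall a, Kpow 3 a -> phi a = 0.

Definition gaussian_kernel : set A :=
  [set a | forall phi : {scalar A}, gaussian phi -> phi a = 0].

Definition Gauss : quantum_subgroup :=
  the_subgroup [set H | qideal H `<=` gaussian_kernel /\
    forall I, hopf_star_ideal I -> I `<=` gaussian_kernel -> I `<=` qideal H].

Definition G00 : quantum_subgroup := the_subgroup [set H | qideal H = Kinfty].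

Section QuotientAntipode.
Variable H : quantum_subgroup.

Definition qequiv (a b : A) : bool := `[< qideal H (a - b) >].

Lemma qequiv_is_equiv : equiv_class_of qequiv.
Proof.
have [[I0 Il _ _] _ _ _ _] := qidealP H.
have sub x y : qideal H x -> qideal H y -> qideal H (y - x).
  by move=> hx hy; rewrite addrC -scaleN1r; exact: Il.
split=> [a|a b|b a c].
- by apply/asboolP; rewrite subrr.
- by apply/asboolP/asboolP => h; rewrite -opprB -sub0r; exact: sub.
- move=> /asboolP h1 /asboolP h2; apply/asboolP.
  have -> : a - c = 1 *: (a - b) + (b - c) by rewrite scale1r addrA subrK.
  exact: Il.
Qed.

Canonical qequiv_rel := EquivRelPack qequiv_is_equiv.

(* The underlying set of O(H) = A / I_H. *)
Definition quotient_algebra := {eq_quot qequiv_rel}.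

Definition qclass (a : A) : quotient_algebra := \pi_quotient_algebra a.

Lemma qclass_eqP (a b : A) : qclass a = qclass b <-> qideal H (a - b).
Proof. by split=> [/eqmodP /asboolP //|h]; apply/eqmodP/asboolP. Qed.

(* The antipode of O(H). *)
Definition qantipode (x : quotient_algebra) : quotient_algebra :=
  qclass (antipode (repr x)).

Lemma qantipodeE a : qantipode (qclass a) = qclass (antipode a).
Proof.
apply/qclass_eqP; rewrite -linearB; apply: (hsi_antipode (qidealP H)).
by apply/qclass_eqP; rewrite /qclass reprK.
Qed.

Definition kac_type : Prop :=
  forall x : quotient_algebra, qantipode (qantipode x) = x.

Lemma kac_typeP :
  kac_type <-> forall a : A, qideal H (antipode (antipode a) - a).
Proof.
split=> [h a|h x]; first by apply/qclass_eqP; rewrite -!qantipodeE.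
have <- : qclass (repr x) = x by rewrite /qclass reprK.
by rewrite !qantipodeE; apply/qclass_eqP.
Qed.

End QuotientAntipode.

Definition Kac : quantum_subgroup := the_subgroup (is_largest_subgroup kac_type).

End QuantumSubgroups.

(* Main.v *)
From HB Require Import structures.
Require Import Defs.
From mathcomp Require Import all_boot all_order all_algebra.
From mathcomp Require Import ring sesquilinear boolp classical_sets reals complex.

(** Write K_n for the powers of the augmentation ideal and D for the square of
    the antipode S.

    The inclusion of Gauss(G) in G^00 is formal once K_infty is known to be a
    Hopf star-ideal: K_infty lies in K_3, hence in the kernel of every Gaussian
    functional, and Gauss(G) is given by the largest Hopf star-ideal with that
    property (it exists because a sum of Hopf star-ideals is one).  For the
    comultiplication of K_infty, multiplicativity puts comul(K_2n) into
    K_n ⊗ A + A ⊗ K_n, and for a decreasing sequence of subspaces the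
    intersection of the spaces V_n ⊗ A + A ⊗ V_n is V ⊗ A + A ⊗ V, where V
    is the intersection of the V_n ([tensor_sub_bigcap]).

    The Kac part is given by the two-sided ideal generated by the elements
    D a - a, which is a Hopf star-ideal.  So the inclusion of G^00 in Kac(G) says
    that D a - a lies in every K_n.  Two facts about D are played against each
    other.

    - D is unipotent modulo K_n.  On the coefficients of a unitary
      corepresentation u one has S(u_ij) = u_ji^*, and the identity u u^* = 1
      gives S a + a - 2 counit(a) in K_2.  Hence D - 1 sends A into K_2; as D is
      multiplicative, D - 1 sends K_n into K_(n+1) ([sqantipode_aug]).

    - D is diagonalizable, in the following form: D(u) = Q u Q^-1 for some
      invertible Hermitian scalar matrix Q ([sqantipode_conjugation]).  The
      entries u_ij^* of the conjugate corepresentation are combinations of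
      coefficients of some unitary corepresentation w.  The matrices f(w), with
      f a functional on A, form a star-algebra P of complex matrices, and
      f(w) |-> f(conj u) is a representation of P.  Every finite-dimensional
      representation of a star-algebra of matrices is a star-representation for
      some inner product ([representation_form]), and the Gram matrix of that
      inner product provides Q.  This replaces the usual argument through the
      Haar state.

    Now let g be a functional that vanishes on K_n and put
    X_k = g((D - 1)^k u).  Then X_(k+1) = Q X_k Q^-1 - X_k, and X_k = 0 for k
    large.  The map X |-> Q X Q^-1 - X is self-adjoint for the Hilbert-Schmidt
    product, so X_1 = 0 already ([hermitian_conj_unipotent]).  Functionals that
    vanish on K_n separate the points outside K_n, so D u - u has its
    entries in K_n. *)

Set Implicit Arguments.
Unset Strict Implicit.
Unset Printing Implicit Defensive.

Import Order.TTheory GRing.Theory Num.Theory.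
Local Open Scope classical_set_scope.
Local Open Scope ring_scope.

(** * Subspaces, spans and separating functionals *)

Section LinearAlgebra.
Variables (K : fieldType) (E : lmodType K).
Implicit Types (V X : set E).

Definition subspace V : Prop :=
  V 0 /\ forall (c : K) x y, V x -> V y -> V (c *: x + y).

Lemma subspaceD V x y : subspace V -> V x -> V y -> V (x + y).
Proof. by move=> [_ h] hx hy; rewrite -[x]scale1r; exact: h. Qed.

Lemma subspaceZ V c x : subspace V -> V x -> V (c *: x).
Proof. by move=> [h0 h] hx; rewrite -[_ *: _]addr0; exact: h. Qed.

Lemma subspaceN V x : subspace V -> V x -> V (- x).
Proof. by move=> hV hx; rewrite -scaleN1r; exact: subspaceZ. Qed.

Lemma subspaceB V x y : subspace V -> V x -> V y -> V (x - y).
Proof. by move=> hV hx hy; apply: subspaceD => //; exact: subspaceN. Qed.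

Lemma subspace_sum V (I : Type) (r : seq I) (P : pred I) (F : I -> E) :
  subspace V -> (forall i, P i -> V (F i)) -> V (\sum_(i <- r | P i) F i).
Proof.
move=> hV h; apply: big_ind => //; first exact: hV.1.
by move=> x y; exact: subspaceD.
Qed.

Lemma span_subspace X : subspace (linear_span X).
Proof.
split=> [|c x y [s [hs ->]] [r [hr ->]]].
  by exists [::]; split=> //; rewrite big_nil.
exists ([seq (c * p.1, p.2) | p <- s] ++ r); split.
  move=> p; rewrite mem_cat => /orP[/mapP[q qs ->]|]; first exact: (hs q).
  exact: hr.
rewrite big_cat big_map scaler_sumr; congr (_ + _).
by apply: eq_bigr => p _; rewrite scalerA.
Qed.

Lemma span_gen X x : X x -> linear_span X x.
Proof.
move=> hx; exists [:: (1, x)]; split=> [p|]; last by rewrite big_seq1 scale1r.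
by rewrite inE => /eqP ->.
Qed.

Lemma span_min X V : subspace V -> X `<=` V -> linear_span X `<=` V.
Proof.
move=> hV h _ [s [hs ->]]; rewrite big_seq; apply: subspace_sum => // p ps.
by apply: subspaceZ => //; apply/h/hs.
Qed.

Lemma spanS X Y : X `<=` Y -> linear_span X `<=` linear_span Y.
Proof.
by move=> h; apply: span_min => [|x /h]; [exact: span_subspace|exact: span_gen].
Qed.

Definition adjoin V (x : E) : set E := [set z | exists c, V (z - c *: x)].

Lemma adjoin_subspace V x : subspace V -> subspace (adjoin V x).
Proof.
move=> hV; split=> [|c y z [a ha] [b hb]].
  by exists 0; rewrite scale0r subr0; exact: hV.1.
exists (c * a + b); have := hV.2 c _ _ ha hb.
by rewrite scalerBr scalerA scalerDl opprD addrACA.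
Qed.

Lemma sub_adjoin V x : V `<=` adjoin V x.
Proof. by move=> y hy; exists 0; rewrite scale0r subr0. Qed.

Lemma mem_adjoin V x : subspace V -> adjoin V x x.
Proof. by move=> hV; exists 1; rewrite scale1r subrr; exact: hV.1. Qed.

Definition mk_scalar (f : E -> K) (hf : scalar f) : {scalar E} :=
  HB.pack f (GRing.isLinear.Build K E K *%R f hf).

(** By Zorn's lemma there is a subspace M that is maximal among those that contain
    V and avoid e.  Maximality forces every x to be congruent modulo M to a
    unique multiple of e; the coefficient is the functional. *)
Lemma separating_functional V e :
  subspace V -> ~ V e -> exists f : {scalar E}, f e = 1 /\ forall v, V v -> f v = 0.
Proof.
move=> hV hVe.
(* The union of the empty chain is set0, whence the first alternative. *)
pose P (M : set E) := M = set0 \/ [/\ subspace M, V `<=` M & ~ M e].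
have [M [PM maxM]] : exists M, P M /\ forall B, M `<` B -> ~ P B.
  apply: Zorn_bigcup => F FP Ftot.
  have [[M0 [FM0 M0n]]|h] := pselect (exists M0, F M0 /\ M0 <> set0); last first.
    left; apply/seteqP; split=> // x [M FM Mx]; apply: h; exists M; split=> //.
    by move=> M0; rewrite M0 in Mx.
  have good M x : F M -> M x -> [/\ subspace M, V `<=` M & ~ M e].
    by move=> FM Mx; have [M0'|//] := FP _ FM; rewrite M0' in Mx.
  have [x0 M0x0] : exists x, M0 x.
    by apply: contrapT => /forallNP h; apply: M0n; apply/seteqP; split.
  have [[M00 _] VM0 _] := good _ _ FM0 M0x0.
  right; split.
  - split=> [|c x y [M FM Mx] [N FN Ny]]; first by exists M0.
    have [MN|NM] := Ftot _ _ FM FN.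
      exists N => //; have [[_ h] _ _] := good _ _ FN Ny.
      by apply: h => //; exact: MN.
    exists M => //; have [[_ h] _ _] := good _ _ FM Mx.
    by apply: h => //; exact: NM.
  - by move=> v hv; exists M0 => //; exact: VM0.
  - by move=> [M FM Me]; have [_ _] := good _ _ FM Me.
have {PM} [hM VM Me] : [/\ subspace M, V `<=` M & ~ M e].
  case: PM => // M0; exfalso; apply: (maxM V); last by right; split.
  by rewrite M0; split=> // /(_ 0 hV.1).
have full x : adjoin M e x.
  apply: contrapT => nx; apply: (maxM (adjoin M x)); last first.
    right; split; first exact: adjoin_subspace.
      by move=> v /VM; exact: sub_adjoin.
    move=> [c hc]; have [c0|cn0] := eqVneq c 0.
      by apply: Me; rewrite c0 scale0r subr0 in hc.
    apply: nx; exists c^-1.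
    have := subspaceZ (- c^-1) hM hc.
    by rewrite scalerBr scalerA mulNr mulVf // scaleN1r opprK addrC scaleNr.
  split; first exact: sub_adjoin.
  move=> /(_ x (mem_adjoin x hM)) Mx; apply: nx; exact: sub_adjoin.
have uniq x a b : M (x - a *: e) -> M (x - b *: e) -> a = b.
  move=> ha hb; apply: contrapT => /eqP; rewrite -subr_eq0 => nab; apply: Me.
  have := subspaceZ (a - b)^-1 hM (subspaceB hM hb ha).
  have -> : x - b *: e - (x - a *: e) = (a - b) *: e.
    by rewrite opprB [LHS]addrC addrA subrK scalerBl.
  by rewrite scalerA mulVf // scale1r.
pose f x := projT1 (cid (full x)).
have fP x : M (x - f x *: e) by rewrite /f; case: (cid _).
have flin : scalar f.
  move=> c x y; apply: uniq (fP _) _; have := hM.2 c _ _ (fP x) (fP y).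
  by rewrite scalerBr scalerA scalerDl opprD addrACA.
exists (mk_scalar flin); split=> [|v hv].
  by apply: (uniq e) (fP e) _; rewrite scale1r subrr; exact: hM.1.
by apply: (uniq v) (fP v) _; rewrite scale0r subr0; exact: VM.
Qed.

End LinearAlgebra.

Lemma span_linear (K : fieldType) (E F : lmodType K) (X : set E)
    (f : {linear E -> F}) (W : set F) :
  subspace W -> (forall x, X x -> W (f x)) ->
  forall x, linear_span X x -> W (f x).
Proof.
move=> [W0 Wl] h; apply: (span_min (V := f @^-1` W)) => //.
by split=> [|c x y hx hy] /=; rewrite ?linear0 ?linearP //; exact: Wl.
Qed.

(** * Tensor products *)

Section Tensors.
Variables (K : fieldType) (U V : lmodType K).

Lemma tpureDl (x x' : U) (y : V) : (x + x') ⊗ y = x ⊗ y + x' ⊗ y.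
Proof. by have := (tpure_bilinear U V).1 y 1 x x'; rewrite /= !scale1r. Qed.

Lemma tpureDr (x : U) (y y' : V) : x ⊗ (y + y') = x ⊗ y + x ⊗ y'.
Proof. by have := (tpure_bilinear U V).2 x 1 y y'; rewrite /= !scale1r. Qed.

Lemma tpure0l (y : V) : (0 : U) ⊗ y = 0.
Proof. by apply: (addrI (0 ⊗ y)); rewrite -tpureDl !addr0. Qed.

Lemma tpure0r (x : U) : x ⊗ (0 : V) = 0.
Proof. by apply: (addrI (x ⊗ 0)); rewrite -tpureDr !addr0. Qed.

Lemma tpureZl c (x : U) (y : V) : (c *: x) ⊗ y = c *: (x ⊗ y).
Proof.
by have := (tpure_bilinear U V).1 y c x 0; rewrite /= addr0 tpure0l addr0.
Qed.

Lemma tpureZr c (x : U) (y : V) : x ⊗ (c *: y) = c *: (x ⊗ y).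
Proof.
by have := (tpure_bilinear U V).2 x c y 0; rewrite /= addr0 tpure0r addr0.
Qed.

Lemma tpureBl (x x' : U) (y : V) : (x - x') ⊗ y = x ⊗ y - x' ⊗ y.
Proof. by rewrite tpureDl -scaleN1r tpureZl scaleN1r. Qed.

Lemma tpureBr (x : U) (y y' : V) : x ⊗ (y - y') = x ⊗ y - x ⊗ y'.
Proof. by rewrite tpureDr -scaleN1r tpureZr scaleN1r. Qed.

Lemma tpure_sumr I (r : seq I) (P : pred I) (x : U) (F : I -> V) :
  x ⊗ (\sum_(i <- r | P i) F i) = \sum_(i <- r | P i) x ⊗ F i.
Proof.
by apply: (big_morph (fun y => x ⊗ y)) => [a b|]; rewrite ?tpureDr ?tpure0r.
Qed.

Definition tlin (W : lmodType K) (b : U -> V -> W)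
    (hb : bilinear_for *:%R *:%R b) : {linear tensor U V -> W} :=
  HB.pack (tlift b) (GRing.isLinear.Build _ _ _ _ (tlift b) (tlift_linear hb)).

Lemma tlin_pure (W : lmodType K) (b : U -> V -> W)
    (hb : bilinear_for *:%R *:%R b) x y : tlin hb (x ⊗ y) = b x y.
Proof. exact: tlift_pure. Qed.

Lemma tensor_sum (t : tensor U V) :
  exists s : seq (U * V), t = \sum_(p <- s) p.1 ⊗ p.2.
Proof.
exists (repr t); rewrite -[LHS]tclass_repr; apply: tensor_ext => W b hb.
rewrite tlift_class // -[tlift b]/(tlin hb : _ -> _) linear_sum /eval_formal.
by apply: eq_bigr => p _; rewrite /= tlift_pure.
Qed.

Lemma tensor_span (t : tensor U V) :
  linear_span [set s | exists x y, s = x ⊗ y] t.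
Proof.
have [s ->] := tensor_sum t; apply: subspace_sum; first exact: span_subspace.
by move=> p _; apply: span_gen; exists p.1, p.2.
Qed.

End Tensors.

(** * Intersections of the subspaces V ⊗ E + E ⊗ V *)

Section Intersection.
Variables (K : fieldType) (E : lmodType K).

(** [tensor_ideal], for a subspace of any vector space. *)
Definition tensor_sub (V : set E) : set (tensor E E) :=
  linear_span [set t | exists x y, (V x \/ V y) /\ t = x ⊗ y].

Lemma tensor_subS (V W : set E) : V `<=` W -> tensor_sub V `<=` tensor_sub W.
Proof.
move=> VW; apply: spanS => _ [x [y [[]/VW h ->]]]; exists x, y; split=> //.
  by left.
by right.
Qed.

Definition adjoins (V : set E) (s : seq E) : set E :=
  foldr (fun x W => adjoin W x) V s.

Lemma adjoins_subspace V s : subspace V -> subspace (adjoins V s).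
Proof. by move=> hV; elim: s => //= x s; exact: adjoin_subspace. Qed.

Lemma sub_adjoins (V : set E) s : V `<=` adjoins V s.
Proof. by elim: s => //= x s IH v /IH; exact: sub_adjoin. Qed.

Lemma mem_adjoins (V : set E) s x : subspace V -> x \in s -> adjoins V s x.
Proof.
move=> hV; elim: s => //= y s IH; rewrite inE => /orP[/eqP ->|/IH].
  exact/mem_adjoin/adjoins_subspace.
exact: sub_adjoin.
Qed.

(** If x is outside some W n, then for m >= n the scalar c with e - c x in W m is
    unique, hence independent of m. *)
Lemma adjoin_bigcap (W : nat -> set E) x e :
  (forall n, subspace (W n)) -> (forall m n, (m <= n)%N -> W n `<=` W m) ->
  (forall n, adjoin (W n) x e) -> adjoin [set z | forall n, W n z] x e.
Proof.
move=> hW decW he; have [hx|] := pselect (forall n, W n x).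
  exists 0 => n; rewrite scale0r subr0; have [c hc] := he n.
  by rewrite -[e](subrK (c *: x)); apply: subspaceD => //; exact: subspaceZ.
move=> /existsNP[n hn]; have [c hc] := he n; exists c => m.
have [d hd] := he (maxn m n).
suff <- : d = c by apply: decW hd; exact: leq_maxl.
apply: contrapT => /eqP; rewrite -subr_eq0 => ncd; apply: hn.
have := subspaceZ (d - c)^-1 (hW n)
  (subspaceB (hW n) hc (decW _ _ (leq_maxr m n) _ hd)).
have -> : e - c *: x - (e - d *: x) = (d - c) *: x.
  by rewrite opprB [LHS]addrC addrA subrK scalerBl.
by rewrite scalerA mulVf // scale1r.
Qed.

Lemma adjoins_bigcap (V : nat -> set E) s e :
  (forall n, subspace (V n)) -> (forall m n, (m <= n)%N -> V n `<=` V m) ->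
  (forall n, adjoins (V n) s e) -> adjoins [set z | forall n, V n z] s e.
Proof.
move=> hV decV; elim: s e => //= x s IH e he.
have decA m n : (m <= n)%N -> adjoins (V n) s `<=` adjoins (V m) s.
  move=> mn; elim: (s) => [|y r IHr] /=; first exact: decV.
  by move=> z [c /IHr hc]; exists c.
have [c hc] := adjoin_bigcap (fun n => adjoins_subspace s (hV n)) decA he.
by exists c; exact: IH.
Qed.

Notation tsum s := (\sum_(p <- s) p.1 ⊗ p.2 : tensor E E).

(** A tensor whose first left factor depends modulo V on the other ones can be
    rewritten, modulo V ⊗ E, with one term less. *)
Lemma tsum_absorb (V : set E) x y (s : seq (E * E)) :
  adjoins V [seq p.1 | p <- s] x ->
  exists r, size r = size s /\ tensor_sub V (x ⊗ y + tsum s - tsum r).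
Proof.
elim: s x => [|p s IH] x /= => [Vx|[c /IH[r [sr hr]]]].
  exists [::]; split=> //; rewrite big_nil addr0 subr0.
  by apply: span_gen; exists x, y; split=> //; left.
exists ((p.1, p.2 + c *: y) :: r); split; first by rewrite /= sr.
move: hr; rewrite !big_cons /=; congr (tensor_sub V).
rewrite -scaleNr tpureDl tpureZl tpureDr tpureZr scaleNr.
rewrite (addrCA (x ⊗ y) (p.1 ⊗ p.2)) -(addrA (p.1 ⊗ p.2) (c *: _)).
rewrite [in RHS]opprD [in RHS]addrACA subrr add0r.
by rewrite opprD addrA (addrAC (x ⊗ y)).
Qed.

Lemma slice_bilinear (f : {scalar E}) :
  bilinear_for *:%R *:%R (fun x y : E => f x *: y).
Proof.
split=> [y|x] c u v /=; first by rewrite linearP /= scalerDl scalerA.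
by rewrite scalerDr !scalerA mulrC.
Qed.

Definition slice (f : {scalar E}) := tlin (slice_bilinear f).

Lemma slice_pure f x y : slice f (x ⊗ y) = f x *: y.
Proof. exact: tlin_pure. Qed.

(** Induction on the number of terms of t, with W the intersection of the V n.
    If the first left factor x depends on the others modulo W, [tsum_absorb]
    removes a term.  Otherwise x is independent of them modulo some V n; slicing
    t by a functional that is 1 at x and 0 on V n and on the other left factors
    leaves the right factor y of x, so y is in all V m and the term x ⊗ y can be
    dropped. *)
Lemma tensor_sub_bigcap (V : nat -> set E) t :
  (forall n, subspace (V n)) -> (forall m n, (m <= n)%N -> V n `<=` V m) ->
  (forall n, tensor_sub (V n) t) -> tensor_sub [set z | forall n, V n z] t.
Proof.
move=> hV decV; set W := [set z | _].
have hW : subspace W.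
  by split=> [n|c x y hx hy n]; [exact: (hV n).1|exact: (hV n).2].
have hT U : subspace (tensor_sub U) by exact: span_subspace.
have [s ->] := tensor_sum t.
have [k] := ubnP (size s); elim: k s => // k IH [|[x y] s].
  by rewrite big_nil => *; exact: (hT W).1.
rewrite big_cons /= ltnS => sk hs.
have [hx|] := pselect (forall n, adjoins (V n) [seq p.1 | p <- s] x).
  have [r [sr hr]] := tsum_absorb y (adjoins_bigcap hV decV hx).
  rewrite -[_ + _](subrK (tsum r)); apply: subspaceD => //.
  apply: IH => [|n]; first by rewrite sr.
  rewrite -[tsum r](subKr (x ⊗ y + tsum s)); apply: subspaceB => //.
  by apply: tensor_subS hr => z; exact.
move=> /existsNP[n hn].
have [f [fx fV]] := separating_functional (adjoins_subspace _ (hV n)) hn.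
have Wy : W y.
  move=> m; apply: (decV m (maxn m n)); first exact: leq_maxl.
  have := hs (maxn m n); set N := maxn m n => hN.
  have fN v : V N v -> f v = 0.
    by move=> hv; apply/fV/sub_adjoins; apply: decV hv; exact: leq_maxr.
  suff <- : slice f (x ⊗ y + tsum s) = y.
    apply: (span_linear (W := V N)) hN => // _ [a [b [[]h ->]]].
      by rewrite slice_pure fN // scale0r; exact: (hV N).1.
    by rewrite slice_pure; exact: subspaceZ.
  rewrite linearD slice_pure fx scale1r linear_sum big_seq big1 ?addr0 // => p ps.
  by rewrite slice_pure fV ?scale0r //; apply: mem_adjoins => //; exact: map_f.
have hxy U : W `<=` U -> tensor_sub U (x ⊗ y).
  by move=> WU; apply: span_gen; exists x, y; split=> //; right; exact: WU.
apply: subspaceD => //; first exact: hxy.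
apply: IH => // m; rewrite -[tsum s](addKr (x ⊗ y)) addrC; apply: subspaceB => //.
by apply: hxy => z; exact.
Qed.

End Intersection.

(** * Star-algebras of complex matrices and their representations *)

Section StarAlgebrasOfMatrices.
Variable C : numClosedFieldType.

Definition ctrmx m n (M : 'M[C]_(m, n)) : 'M[C]_(n, m) := (map_mx Num.conj M)^T.

Lemma ctrmxM m n p (M : 'M[C]_(m, n)) (N : 'M[C]_(n, p)) :
  ctrmx (M *m N) = ctrmx N *m ctrmx M.
Proof. by rewrite /ctrmx map_mxM trmx_mul. Qed.

Lemma ctrmxK m n (M : 'M[C]_(m, n)) : ctrmx (ctrmx M) = M.
Proof. by apply/matrixP=> i j; rewrite !mxE conjCK. Qed.

Lemma mxtrace_ctrmx n (M : 'M[C]_n) : \tr (ctrmx M) = (\tr M)^*.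
Proof. by rewrite /mxtrace rmorph_sum; apply: eq_bigr => i _; rewrite !mxE. Qed.

Lemma ctrmx_linear m n (a : C) (M N : 'M[C]_(m, n)) :
  ctrmx (a *: M + N) = a^* *: ctrmx M + ctrmx N.
Proof. by apply/matrixP=> i j; rewrite !mxE rmorphD rmorphM. Qed.

Lemma ctrmx0 m n : ctrmx (0 : 'M[C]_(m, n)) = 0.
Proof. by apply/matrixP=> i j; rewrite !mxE rmorph0. Qed.

Lemma ctrmxZ m n (a : C) (M : 'M[C]_(m, n)) : ctrmx (a *: M) = a^* *: ctrmx M.
Proof. by rewrite -[_ *: M]addr0 ctrmx_linear ctrmx0 addr0. Qed.

Lemma ctrmx_sum m n (I : Type) (r : seq I) (F : I -> 'M[C]_(m, n)) :
  ctrmx (\sum_(i <- r) F i) = \sum_(i <- r) ctrmx (F i).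
Proof.
apply: (big_morph (@ctrmx m n)) => [M N|]; last exact: ctrmx0.
by rewrite -[M]scale1r ctrmx_linear rmorph1 !scale1r.
Qed.

Definition hsdot m n (M N : 'M[C]_(m, n)) : C := \tr (ctrmx M *m N).

Lemma hsdotE m n (M N : 'M[C]_(m, n)) :
  hsdot M N = \sum_i \sum_j (M j i)^* * N j i.
Proof.
by rewrite /hsdot /mxtrace; apply: eq_bigr => i _; rewrite !mxE;
   apply: eq_bigr => j _; rewrite !mxE.
Qed.

Lemma hsdot_linear m n (M : 'M[C]_(m, n)) : scalar (hsdot M).
Proof.
by move=> a N P; rewrite /hsdot mulmxDr -scalemxAr mxtraceD mxtraceZ.
Qed.

Lemma hsdotC m n (M N : 'M[C]_(m, n)) : hsdot M N = (hsdot N M)^*.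
Proof. by rewrite /hsdot -mxtrace_ctrmx ctrmxM ctrmxK. Qed.

Lemma hsdot_ge0 m n (M : 'M[C]_(m, n)) : 0 <= hsdot M M.
Proof.
rewrite hsdotE; apply: sumr_ge0 => i _; apply: sumr_ge0 => j _.
by rewrite mulrC mul_conjC_ge0.
Qed.

Lemma hsdot_eq0 m n (M : 'M[C]_(m, n)) : hsdot M M = 0 -> M = 0.
Proof.
rewrite hsdotE => /eqP; rewrite psumr_eq0; last first.
  by move=> i _; apply: sumr_ge0 => j _; rewrite mulrC mul_conjC_ge0.
move=> /allP h; apply/matrixP => j i; rewrite mxE.
have := h i (mem_index_enum _); rewrite implyTb psumr_eq0; last first.
  by move=> k _; rewrite mulrC mul_conjC_ge0.
move=> /allP /(_ j (mem_index_enum _)); rewrite implyTb mulrC mul_conjC_eq0.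
by move/eqP.
Qed.

Definition hslin m n (M : 'M[C]_(m, n)) : {scalar 'M[C]_(m, n)} :=
  mk_scalar (hsdot_linear M).

Lemma hsdotZr m n (M N : 'M[C]_(m, n)) a : hsdot M (a *: N) = a * hsdot M N.
Proof. exact: (scalarZ (hslin M)). Qed.

Lemma hsdotDr m n (M N P : 'M[C]_(m, n)) :
  hsdot M (N + P) = hsdot M N + hsdot M P.
Proof. exact: (linearD (hslin M)). Qed.

Lemma hsdotBr m n (M N P : 'M[C]_(m, n)) :
  hsdot M (N - P) = hsdot M N - hsdot M P.
Proof. exact: (linearB (hslin M)). Qed.

Lemma hsdot_sumr m n (M : 'M[C]_(m, n)) (I : Type) (r : seq I) F :
  hsdot M (\sum_(i <- r) F i) = \sum_(i <- r) hsdot M (F i).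
Proof. exact: (linear_sum (hslin M)). Qed.

Lemma hsdotZl m n (M N : 'M[C]_(m, n)) a : hsdot (a *: M) N = a^* * hsdot M N.
Proof. by rewrite hsdotC hsdotZr rmorphM [in RHS]hsdotC. Qed.

Lemma hsdot_suml m n (M : 'M[C]_(m, n)) (I : Type) (r : seq I) F :
  hsdot (\sum_(i <- r) F i) M = \sum_(i <- r) hsdot (F i) M.
Proof.
by rewrite hsdotC hsdot_sumr rmorph_sum; apply: eq_bigr => i _; rewrite [RHS]hsdotC.
Qed.

(** Gram-Schmidt along a list s of coordinates which determine the elements of P.
    The family b is in fact built orthonormal, but only the expansion formula is
    kept: it alone implies that the residue e below is orthogonal to b. *)
Lemma parseval_frame_on m n (s : seq ('I_m * 'I_n)) (P : set 'M[C]_(m, n)) :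
  subspace P ->
  (forall M, P M -> (forall p, p \in s -> M p.1 p.2 = 0) -> M = 0) ->
  exists b : seq 'M[C]_(m, n), (forall M, M \in b -> P M) /\
    forall M, P M -> M = \sum_(N <- b) hsdot N M *: N.
Proof.
elim: s P => [|[i j] s IH] P hP sepP.
  by exists [::]; split=> // M PM; rewrite big_nil; exact: sepP.
pose P' : set 'M[C]_(m, n) := [set M | P M /\ M i j = 0].
have hP' : subspace P'.
  split=> [|a M N [PM M0] [PN N0]]; first by split; [exact: hP.1|rewrite mxE].
  by split; [exact: hP.2|rewrite !mxE M0 N0 mulr0 addr0].
have [|b [bP' bE]] := IH P' hP'.
  move=> M [PM M0] hM; apply: sepP => // p; rewrite inE => /orP[/eqP ->//|].
  exact: hM.
have [[M1 [PM1 M1n0]]|h] := pselect (exists M, P M /\ M i j != 0); last first.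
  exists b; split=> [M /bP'[]//|M PM]; apply: bE; split=> //.
  by apply: contrapT => /eqP n0; apply: h; exists M.
pose M2 := (M1 i j)^-1 *: M1.
pose e := M2 - \sum_(N <- b) hsdot N M2 *: N.
have sumP' M : P' (\sum_(N <- b) hsdot N M *: N).
  rewrite big_seq; apply: subspace_sum => // N Nb.
  by apply: subspaceZ => //; exact: bP'.
have Pe : P e.
  apply: subspaceB => //; first exact: subspaceZ.
  by case: (sumP' M2).
have eij : e i j = 1.
  have [_ h0] := sumP' M2.
  by rewrite /e [LHS]mxE [X in _ + X]mxE h0 oppr0 addr0 mxE mulVf.
(* The operator M |-> \sum_N hsdot N M *: N is self-adjoint and fixes b. *)
have edot N : N \in b -> hsdot N e = 0.
  move=> Nb; rewrite hsdotBr hsdot_sumr {1}(bE _ (bP' _ Nb)) hsdot_suml.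
  apply/eqP; rewrite subr_eq0; apply/eqP; apply: eq_bigr => L _.
  by rewrite hsdotZl hsdotZr mulrC [hsdot N L]hsdotC.
have ee : hsdot e e != 0.
  apply/eqP => /hsdot_eq0 e0; have := eij; rewrite e0 mxE => /eqP.
  by rewrite eq_sym oner_eq0.
pose c := (sqrtC (hsdot e e))^-1.
have cc : c * c^* * hsdot e e = 1.
  rewrite /c conj_Creal ?ger0_real ?invr_ge0 ?sqrtC_ge0 ?hsdot_ge0 //.
  by rewrite -invfM -expr2 sqrtCK mulVf.
exists (c *: e :: b); split=> [M|M PM].
  rewrite inE => /orP[/eqP ->|/bP'[]//]; exact: subspaceZ.
have PM' : P' (M - M i j *: e).
  split; first by apply: subspaceB => //; exact: subspaceZ.
  by rewrite [LHS]mxE [X in _ + X]mxE [X in - X]mxE eij mulr1 subrr.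
set a := M i j in PM' *; set M' := M - a *: e in PM' *.
have ME : M = a *: e + M' by rewrite addrC subrK.
have eM' : hsdot e M' = 0.
  rewrite (bE _ PM') hsdot_sumr big_seq big1 // => N Nb.
  by rewrite hsdotZr [hsdot e N]hsdotC edot // rmorph0 mulr0.
rewrite big_cons {1}ME {1}(bE _ PM'); congr (_ + _).
  rewrite ME hsdotZl hsdotDr hsdotZr eM' addr0 scalerA.
  transitivity ((a * (c * c^* * hsdot e e)) *: e); first by rewrite cc mulr1.
  by congr (_ *: _); ring.
rewrite big_seq [RHS]big_seq; apply: eq_bigr => N Nb.
by rewrite ME [in RHS]hsdotDr hsdotZr edot // mulr0 add0r.
Qed.

Lemma parseval_frame m n (P : set 'M[C]_(m, n)) : subspace P ->
  exists b : seq 'M[C]_(m, n), (forall M, M \in b -> P M) /\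
    forall M, P M -> M = \sum_(N <- b) hsdot N M *: N.
Proof.
move=> hP; apply: (@parseval_frame_on _ _ (enum {: 'I_m * 'I_n})) => //.
by move=> M _ h; apply/matrixP=> i j; rewrite mxE (h (i, j)) // mem_enum.
Qed.

(** With b a Parseval frame of P for the Hilbert-Schmidt product, the form is
    Q = \sum_(N <- b) ctrmx (rho N) *m rho N.  Expanding N *m M and N *m ctrmx M
    in the frame turns both sides of the intertwining relation into the same
    double sum, because \tr (ctrmx L *m N *m M) is the conjugate of
    \tr (ctrmx N *m L *m ctrmx M).  A vector in the kernel of Q is killed by all
    rho N, hence by rho 1%:M = 1%:M. *)
Lemma representation_form n d (P : set 'M[C]_n)
    (rho : {linear 'M[C]_n -> 'M[C]_d}) :
  subspace P -> P 1%:M ->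
  (forall M N, P M -> P N -> P (M *m N)) ->
  (forall M, P M -> P (ctrmx M)) ->
  rho 1%:M = 1%:M ->
  (forall M N, P M -> P N -> rho (M *m N) = rho M *m rho N) ->
  exists Q : 'M[C]_d, [/\ Q \in unitmx, ctrmx Q = Q &
    forall M, P M -> Q *m rho M = ctrmx (rho (ctrmx M)) *m Q].
Proof.
move=> hP P1 PM Pc rho1 rhoM; have [b [bP bE]] := parseval_frame hP.
exists (\sum_(N <- b) ctrmx (rho N) *m rho N); split.
- rewrite unitmxE unitfE; apply/negP => /det0P[v vn0 vQ].
  have : \sum_(N <- b) hsdot (rho N *m ctrmx v) (rho N *m ctrmx v) = 0.
    transitivity (\tr (v *m (\sum_(N <- b) ctrmx (rho N) *m rho N) *m ctrmx v)).
      rewrite mulmx_sumr mulmx_suml raddf_sum; apply: eq_bigr => N _.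
      by rewrite /hsdot ctrmxM ctrmxK !mulmxA.
    by rewrite vQ mul0mx mxtrace0.
  move/eqP; rewrite psumr_eq0 => [/allP h|N _]; last exact: hsdot_ge0.
  move: vn0; rewrite -[v]ctrmxK -[ctrmx v]mul1mx -rho1 [in rho _](bE _ P1).
  rewrite linear_sum mulmx_suml big_seq big1 ?ctrmx0 ?eqxx // => N Nb.
  have /eqP/hsdot_eq0 := h N Nb.
  by rewrite linearZ -scalemxAl => ->; rewrite scaler0.
- by rewrite ctrmx_sum; apply: eq_bigr => N _; rewrite ctrmxM ctrmxK.
- move=> M PMM; rewrite mulmx_suml mulmx_sumr.
  have PE N : N \in b -> ctrmx (rho N) *m rho N *m rho M =
      \sum_(L <- b) hsdot L (N *m M) *: (ctrmx (rho N) *m rho L).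
    move=> Nb; rewrite -mulmxA -rhoM //; last exact: bP.
    rewrite {1}(bE (N *m M)); last by apply: PM => //; exact: bP.
    rewrite linear_sum mulmx_sumr; apply: eq_bigr => L _.
    by rewrite linearZ -scalemxAr.
  have PE' N : N \in b -> ctrmx (rho (ctrmx M)) *m (ctrmx (rho N) *m rho N) =
      \sum_(L <- b) hsdot N (L *m M) *: (ctrmx (rho L) *m rho N).
    move=> Nb; rewrite mulmxA -ctrmxM -rhoM //; [|exact: bP|exact: Pc].
    rewrite {1}(bE (N *m ctrmx M)); last by apply: PM; [exact: bP|exact: Pc].
    rewrite linear_sum ctrmx_sum mulmx_suml; apply: eq_bigr => L _.
    rewrite linearZ /= ctrmxZ -scalemxAl.
    congr (_ *: _); rewrite /hsdot -mxtrace_ctrmx !ctrmxM !ctrmxK.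
    by rewrite -mulmxA mxtrace_mulC -mulmxA.
  rewrite big_seq (eq_bigr _ PE) -big_seq exchange_big /=.
  by rewrite [RHS]big_seq (eq_bigr _ PE') -big_seq.
Qed.

(** The map X |-> Q X Q^-1 - X is self-adjoint for the Hilbert-Schmidt product
    when Q is Hermitian, and a self-adjoint nilpotent operator is zero. *)
Lemma hermitian_conj_unipotent d (Q : 'M[C]_d) k (X : nat -> 'M[C]_d) :
  Q \in unitmx -> ctrmx Q = Q ->
  (forall i, X i.+1 *m Q = Q *m X i - X i *m Q) ->
  X k.+1 = 0 -> X 1%N = 0.
Proof.
move=> Qu Qh hX.
have step i : X i.+2 = 0 -> X i.+1 = 0.
  move=> h; apply: hsdot_eq0; set Y := X i.+1.
  have QY : Y *m Q = Q *m Y.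
    by apply/eqP; rewrite eq_sym -subr_eq0 -hX h mul0mx.
  have QYc : ctrmx Y *m Q = Q *m ctrmx Y.
    by rewrite -{1}Qh -ctrmxM -QY ctrmxM Qh.
  have YE : Y = Q *m X i *m invmx Q - X i.
    rewrite -[LHS](mulmxK Qu) hX mulmxBl; congr (_ - _).
    by rewrite -mulmxA mulmxV // mulmx1.
  (* \tr (Y^* Q X Q^-1) = \tr (Y^* X), as Y^* commutes with Q *)
  rewrite /hsdot {2}YE mulmxBr raddfB /= !mulmxA QYc mxtrace_mulC !mulmxA.
  by rewrite mulVmx // mul1mx subrr.
by elim: k => // k IH /step.
Qed.

End StarAlgebrasOfMatrices.

(** * Star-algebras and the tensor square of an algebra *)

Section StarAlgebra.
Variables (C : numClosedFieldType) (A : starAlgType C).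
Implicit Types x y : A.

Lemma starD x y : star (x + y) = star x + star y.
Proof. by have := star_conjlinear 1 x y; rewrite rmorph1 !scale1r. Qed.

Lemma star0 : star (0 : A) = 0.
Proof. by apply: (addrI (star 0)); rewrite -starD !addr0. Qed.

Lemma starZ a x : star (a *: x) = a^* *: star x.
Proof. by have := star_conjlinear a x 0; rewrite star0 !addr0. Qed.

Lemma starN x : star (- x) = - star x.
Proof. by rewrite -scaleN1r starZ rmorphN1 scaleN1r. Qed.

Lemma starB x y : star (x - y) = star x - star y.
Proof. by rewrite starD starN. Qed.

Lemma star1 : star (1 : A) = 1.
Proof. by rewrite -[LHS]mulr1 -[1 in X in _ * X]starK -starM mulr1 starK. Qed.

Lemma star_nat n : star (n%:R : A) = n%:R.
Proof. by elim: n => [|n IH]; rewrite ?star0 // -natr1 starD IH star1. Qed.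

Lemma span_star (X W : set A) : subspace W -> (forall x, X x -> W (star x)) ->
  forall x, linear_span X x -> W (star x).
Proof.
move=> [W0 Wl] h; apply: (span_min (V := star @^-1` W)) => //.
by split=> [|c x y hx hy] /=; rewrite ?star0 // star_conjlinear; exact: Wl.
Qed.

(** The conjugate-linear map [tstar] is linear as a map into the conjugate
    module, which is why it commutes with sums. *)
Lemma tstar_sum I (r : seq I) (F G : I -> A) :
  tstar (\sum_(i <- r) F i ⊗ G i) = \sum_(i <- r) star (F i) ⊗ star (G i).
Proof.
pose B (x y : A) : conj_module (tensor A A) := star x ⊗ star y.
have hB : bilinear_for *:%R *:%R B.
  by split=> [w|z] k p q; rewrite /B star_conjlinear ?(tpure_bilinear _ _).1
    ?(tpure_bilinear _ _).2.
transitivity (\sum_(i <- r) tlin hB (F i ⊗ G i)).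
  exact: (linear_sum (tlin hB)).
by apply: eq_bigr => i _; exact: (tlin_pure hB).
Qed.

End StarAlgebra.

Section TensorSquare.
Variables (K : fieldType) (A : algType K).

Lemma mulr_linear (y : A) : linear (fun x : A => x * y).
Proof. by move=> c a b; rewrite mulrDl scalerAl. Qed.

Definition mulr_lin (y : A) : {linear A -> A} :=
  HB.pack (fun x : A => x * y) (GRing.isLinear.Build _ _ _ _ _ (mulr_linear y)).

Lemma tmul_pure_bilinear (a b : A) :
  bilinear_for *:%R *:%R (fun c d : A => (a * c) ⊗ (b * d)).
Proof.
split=> [d|c] k p q /=; rewrite mulrDr -scalerAr.
- by rewrite tpureDl tpureZl.
- by rewrite tpureDr tpureZr.
Qed.

Lemma tmul_linearr (s : tensor A A) : linear (tmul s).
Proof.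
move=> k t u; rewrite /tmul {1}/tlift /eval_formal.
under eq_bigr => p _ do rewrite (tlift_linear (tmul_pure_bilinear _ _)).
by rewrite big_split scaler_sumr.
Qed.

Lemma tmul_linearl (t : tensor A A) : linear (fun s => tmul s t).
Proof.
apply: tlift_linear; split=> [w|z] k p q;
  rewrite /= /tlift /eval_formal scaler_sumr -big_split /=; apply: eq_bigr => i _;
  rewrite mulrDl -scalerAl.
- by rewrite tpureDl tpureZl.
- by rewrite tpureDr tpureZr.
Qed.

Definition tmulr s : {linear tensor A A -> tensor A A} :=
  HB.pack (tmul s) (GRing.isLinear.Build _ _ _ _ (tmul s) (tmul_linearr s)).
Definition tmull t : {linear tensor A A -> tensor A A} :=
  HB.pack (fun s => tmul s t)
    (GRing.isLinear.Build _ _ _ _ (fun s => tmul s t) (tmul_linearl t)).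

Lemma tmul_sum I J (r : seq I) (s : seq J) (F G : I -> A) (F' G' : J -> A) :
  tmul (\sum_(i <- r) F i ⊗ G i) (\sum_(j <- s) F' j ⊗ G' j) =
  \sum_(i <- r) \sum_(j <- s) (F i * F' j) ⊗ (G i * G' j).
Proof.
rewrite -[LHS]/(tmull _ _) linear_sum; apply: eq_bigr => i _.
rewrite -[LHS]/(tmulr _ _) linear_sum; apply: eq_bigr => j _; exact: tmul_pure.
Qed.

Lemma tmul_span (X Y : set (tensor A A)) (W : set (tensor A A)) : subspace W ->
  (forall x y, X x -> Y y -> W (tmul x y)) ->
  forall x y, linear_span X x -> linear_span Y y -> W (tmul x y).
Proof.
move=> hW h x y hx; apply: (span_linear (f := tmulr x)) => // z hz.
by apply: (span_linear (f := tmull z)) hx => // t ht; exact: h.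
Qed.

End TensorSquare.

(** * The antipode on coefficients of unitary corepresentations *)

Section KroneckerSums.
Variable R : pzRingType.

Lemma delta_sum (I : finType) (F : I -> R) j :
  \sum_i F i * (i == j)%:R = F j.
Proof.
rewrite (bigD1 j) //= eqxx mulr1 big1 ?addr0 // => i /negPf ->.
by rewrite mulr0.
Qed.

Lemma delta_suml (I : finType) (F : I -> R) j :
  \sum_i (j == i)%:R * F i = F j.
Proof.
rewrite (bigD1 j) //= eqxx mul1r big1 ?addr0 // => i; rewrite eq_sym => /negPf ->.
by rewrite mul0r.
Qed.

End KroneckerSums.

Section Antipode.
Variables (C : numClosedFieldType) (A : cqgAlgType C).
Implicit Types (a b : A).

Lemma antipodel_bilinear :
  bilinear_for *:%R *:%R (fun x y : A => antipode x * y).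
Proof.
by split=> [y|x] k p q /=; rewrite ?linearP ?mulrDl ?mulrDr -?scalerAl -?scalerAr.
Qed.

(** The antipode axiom makes (antipode (w i j)) a left inverse of w, and star w^T
    is a right inverse, so the two agree.  The index set is an arbitrary finite
    type so that the lemma applies to tensor products of corepresentations. *)
Lemma antipode_coefficient (I : finType) (w : I -> I -> A) :
  (forall i j, comul (w i j) = \sum_k w i k ⊗ w k j) ->
  (forall i j, counit (w i j) = (i == j)%:R) ->
  (forall i j, \sum_k w i k * star (w j k) = (i == j)%:R) ->
  forall i j, antipode (w i j) = star (w j i).
Proof.
move=> wD we wu i j.
have Sw l : \sum_k antipode (w i k) * w k l = (i == l)%:R.
  have := antipodel (w i l); rewrite wD we -[tlift _ _]/(tlin antipodel_bilinear _).
  rewrite linear_sum scaler_nat => <-; apply: eq_bigr => k _; exact/esym/tlin_pure.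
transitivity (\sum_l \sum_k antipode (w i k) * (w k l * star (w j l))).
  rewrite exchange_big /= -[LHS](delta_sum (fun k => antipode (w i k))).
  apply: eq_bigr => k _.
  by rewrite -mulr_sumr wu.
under eq_bigr => l _ do under eq_bigr => k _ do rewrite mulrA.
under eq_bigr => l _ do rewrite -mulr_suml Sw.
by rewrite delta_suml.
Qed.

Section UnitaryCorepresentation.
Variables (n : nat) (u : 'M[A]_n).
Hypothesis hu : unitary_corepresentation u.

Lemma comul_coef i j : comul (u i j) = \sum_k u i k ⊗ u k j.
Proof. by case: hu => h _ _; case: (h i j). Qed.

Lemma counit_coef i j : counit (u i j) = (i == j)%:R :> C.
Proof. by case: hu => h _ _; case: (h i j). Qed.

Lemma unitary_right i j : \sum_k u i k * star (u j k) = (i == j)%:R.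
Proof.
case: hu => _ /matrixP/(_ i j); rewrite !mxE => <- _.
by apply: eq_bigr => k _; rewrite mxE.
Qed.

Lemma antipode_coef i j : antipode (u i j) = star (u j i).
Proof. exact: antipode_coefficient comul_coef counit_coef unitary_right i j. Qed.

Lemma counit_star_coef i j : counit (star (u i j)) = (i == j)%:R :> C.
Proof.
have /(congr1 (fun a => counit a : C)) := unitary_right j i.
rewrite rmorph_nat rmorph_sum => h; rewrite eq_sym -h.
rewrite (bigD1 j) //= big1 ?addr0 => [|k /negPf kj]; last first.
  by rewrite rmorphM /= counit_coef eq_sym kj mul0r.
by rewrite rmorphM /= counit_coef eqxx mul1r.
Qed.

End UnitaryCorepresentation.

Lemma coef_ind (P : set A) : subspace P ->
  (forall n (u : 'M[A]_n) i j, unitary_corepresentation u -> P (u i j)) ->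
  forall a, P a.
Proof.
move=> hP h a; apply: span_min (cqg_span a) => // _ [n [u [i [j [hu ->]]]]].
exact: h.
Qed.

Lemma coef_ext (F : lmodType C) (f g : {linear A -> F}) :
  (forall n (u : 'M[A]_n) i j, unitary_corepresentation u ->
     f (u i j) = g (u i j)) -> f =1 g.
Proof.
move=> h a; apply: (coef_ind (P := [set a | f a = g a])) a => //.
by split=> [|c x y hx hy] /=; rewrite ?linear0 // !linearP hx hy.
Qed.

Lemma counit_star a : counit (star a) = (counit a)^* :> C.
Proof.
apply: (coef_ind (P := [set a | counit (star a) = (counit a)^* :> C])) a => /=.
  split=> [|c x y /= hx hy]; first by rewrite /= star0 linear0 rmorph0.
  by rewrite star_conjlinear !linearP /= rmorphD rmorphM /= hx hy.
by move=> n u i j hu; rewrite counit_star_coef // counit_coef // rmorph_nat.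
Qed.

Lemma counit_antipode a : counit (antipode a) = counit a :> C.
Proof.
apply: (coef_ext (f := counit \o antipode) (g := counit)) => n u i j hu /=.
by rewrite antipode_coef // counit_star_coef // counit_coef // eq_sym.
Qed.

(** The products u i j * v k l are the coefficients of the tensor product of u and
    v, which is again unitary: both sides are computed by
    [antipode_coefficient]. *)
Lemma antipodeM a b : antipode (a * b) = antipode b * antipode a.
Proof.
pose P b : set A := [set a | antipode (a * b) = antipode b * antipode a].
have hP c : subspace (P c).
  split=> [|k x y hx hy]; rewrite /P /=.
    by rewrite linear0 mulr0 mul0r linear0.
  by rewrite mulrDl -scalerAl !linearP hx hy mulrDr -scalerAr.
apply: (coef_ind (P := P b)) a => // n u i j hu.
have hP' : subspace [set b | P b (u i j)].
  split=> [|k x y hx hy]; rewrite /P /=.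
    by rewrite linear0 mulr0 mul0r linear0.
  by rewrite mulrDr -scalerAr !linearP hx hy mulrDl -scalerAl.
apply: (coef_ind hP') b => m v k l hv; rewrite /P /=.
pose w (p q : 'I_n * 'I_m) := u p.1 q.1 * v p.2 q.2.
have h := @antipode_coefficient _ w _ _ _ (i, k) (j, l).
rewrite -[u i j * _]/(w (i, k) (j, l)) h.
- by rewrite /w /= starM !antipode_coef.
- move=> p q; rewrite /w comulM !comul_coef // tmul_sum pair_big /=.
  by apply: eq_bigr.
- move=> p q; rewrite /w rmorphM /= !counit_coef // -natrM mulnb.
  by rewrite -pair_eqE.
- move=> p q; rewrite /w -(pair_big xpredT xpredT (fun x y =>
    u p.1 x * v p.2 y * star (u q.1 x * v q.2 y))) /=.
  transitivity (\sum_x u p.1 x * (p.2 == q.2)%:R * star (u q.1 x)).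
    apply: eq_bigr => x _; rewrite -(unitary_right hv) mulr_sumr mulr_suml.
    by apply: eq_bigr => y _; rewrite starM !mulrA.
  under eq_bigr => x _ do rewrite -mulrA -commr_nat mulrA.
  by rewrite -mulr_suml unitary_right // -natrM mulnb -pair_eqE.
Qed.

Lemma unitary1 : unitary_corepresentation (1%:M : 'M[A]_1).
Proof.
split=> [i j||]; rewrite ?mul1mx ?mulmx1.
- rewrite !ord1 !mxE eqxx /= big_ord1 !mxE eqxx /= comul1; split=> //.
  exact: rmorph1.
- by apply/matrixP=> i j; rewrite !ord1 !mxE eqxx star1.
- by apply/matrixP=> i j; rewrite !ord1 !mxE eqxx star1.
Qed.

Lemma star_antipodeK a : star (antipode (star (antipode a))) = a.
Proof.
apply: (coef_ind (P := [set a | star (antipode (star (antipode a))) = a])) a => /=.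
  split=> [|c x y /= hx hy]; first by rewrite /= linear0 star0 linear0 star0.
  by rewrite linearP star_conjlinear linearP star_conjlinear conjCK hx hy.
by move=> n u i j hu; rewrite antipode_coef // starK antipode_coef // starK.
Qed.

Lemma flip_antipode_bilinear :
  bilinear_for *:%R *:%R (fun x y : A => antipode y ⊗ antipode x).
Proof.
by split=> [y|x] k p q /=; rewrite linearP ?tpureDl ?tpureDr ?tpureZl ?tpureZr.
Qed.

(** The antipode reverses the comultiplication; on unitary coefficients this is
    the compatibility of the comultiplication with the involution. *)
Lemma comul_antipode a :
  comul (antipode a) = tlin flip_antipode_bilinear (comul a).
Proof.
apply: (coef_ext (f := comul \o antipode)
  (g := tlin flip_antipode_bilinear \o comul)) => n u i j hu /=.
rewrite antipode_coef // comul_star !comul_coef // tstar_sum.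
rewrite -[tlift _ _]/(tlin flip_antipode_bilinear _) linear_sum.
apply: eq_bigr => k _.
by rewrite [RHS]tlin_pure !antipode_coef.
Qed.

Lemma comul_antipode_sum a (s : seq (A * A)) (F G : A * A -> A) :
  comul a = \sum_(p <- s) F p ⊗ G p ->
  comul (antipode a) = \sum_(p <- s) antipode (G p) ⊗ antipode (F p).
Proof.
move=> ha; rewrite comul_antipode ha linear_sum; apply: eq_bigr => p _.
exact: tlin_pure.
Qed.

Definition sqantipode : {linear A -> A} := antipode \o antipode.

Lemma comul_sqantipode a (s : seq (A * A)) :
  comul a = \sum_(p <- s) p.1 ⊗ p.2 ->
  comul (sqantipode a) = \sum_(p <- s) sqantipode p.1 ⊗ sqantipode p.2.
Proof. by move=> ha; do 2!apply: comul_antipode_sum. Qed.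

Lemma sqantipodeM a b : sqantipode (a * b) = sqantipode a * sqantipode b.
Proof. by rewrite /= !antipodeM. Qed.

End Antipode.

(** * The filtration by powers of the augmentation ideal *)

Section AugmentationFiltration.
Variables (C : numClosedFieldType) (A : cqgAlgType C).
Implicit Types (a b x y z : A).

(** The powers K_n of the augmentation ideal, extended by K_0 = A so that
    K_i K_j lies in K_(i+j) for all i and j. *)
Fixpoint aug_power n : set A :=
  if n is m.+1 then
    linear_span [set a | exists x y, [/\ counit x = 0, aug_power m y & a = x * y]]
  else setT.

Lemma aug_subspace n : subspace (aug_power n).
Proof. by case: n => [|n]; [split|exact: span_subspace]. Qed.

Lemma aug_mulkerl n x y : counit x = 0 -> aug_power n y -> aug_power n.+1 (x * y).
Proof. by move=> hx hy; apply: span_gen; exists x, y. Qed.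

Lemma aug_mull n a y : aug_power n y -> aug_power n (a * y).
Proof.
case: n => [//|n].
apply: (span_linear (f := a \*o idfun)) => [|_ [x [z [hx hz ->]]]].
  exact: aug_subspace.
by rewrite /= mulrA; apply: aug_mulkerl; rewrite // rmorphM /= hx mulr0.
Qed.

Lemma augM m n x y :
  aug_power m x -> aug_power n y -> aug_power (m + n) (x * y).
Proof.
elim: m x => [|m IH] x; first by move=> _; exact: aug_mull.
move=> hx hy; apply: (span_linear (f := mulr_lin y)) hx => [|_ [p [z [hp hz ->]]]].
  exact: aug_subspace.
by rewrite /= -mulrA; apply: aug_mulkerl => //; exact: IH.
Qed.

Lemma aug_mulr n x a : aug_power n x -> aug_power n (x * a).
Proof. by move=> hx; rewrite -[n]addn0; exact: augM. Qed.

Lemma counit_ker_subspace : subspace [set x : A | counit x = 0].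
Proof.
by split=> [|c x y /= hx hy]; rewrite /= ?linear0 // linearP /= hx hy addr0 scaler0.
Qed.

Lemma aug1P x : aug_power 1 x <-> counit x = 0.
Proof.
split=> [|hx]; last by rewrite -[x]mulr1; exact: aug_mulkerl.
apply: (span_min counit_ker_subspace) => _ [y [z [hy _ ->]]] /=.
by rewrite rmorphM /= hy mul0r.
Qed.

Lemma augS n : aug_power n.+1 `<=` aug_power n.
Proof.
by apply: span_min => [|_ [x [y [_ hy ->]]]]; [exact: aug_subspace|exact: aug_mull].
Qed.

Lemma aug_le m n : (m <= n)%N -> aug_power n `<=` aug_power m.
Proof. by move=> /subnK <-; elim: (n - m)%N => // k IH x /augS /IH. Qed.

Lemma aug_star n x : aug_power n x -> aug_power n (star x).
Proof.
elim: n x => // n IH x; apply: span_star; first exact: aug_subspace.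
move=> _ [y [z [hy hz ->]]]; rewrite starM -addn1; apply: augM; first exact: IH.
by apply/aug1P; rewrite [LHS]counit_star hy rmorph0.
Qed.

Lemma aug_antipode n x : aug_power n x -> aug_power n (antipode x).
Proof.
elim: n x => // n IH x.
apply: (span_linear (f := @antipode C A)); first exact: aug_subspace.
move=> _ [y [z [hy hz ->]]]; rewrite antipodeM -addn1; apply: augM; first exact: IH.
by apply/aug1P; rewrite [LHS]counit_antipode.
Qed.

Lemma aug_prod n (F : 'I_n -> A) :
  (forall i, counit (F i) = 0) -> aug_power n (\prod_(i < n) F i).
Proof.
elim: n F => // n IH F hF; rewrite big_ord_recl.
by apply: aug_mulkerl => //; exact: IH.
Qed.

Lemma Kpow_aug n : (0 < n)%N -> Kpow n = aug_power n :> set A.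
Proof.
move=> n0; apply/seteqP; split.
  apply: span_min => [|_ [s [hs ->]]]; first exact: aug_subspace.
  exact: aug_prod.
case: n n0 => // n _; elim: n => [|n IH].
  move=> x /aug1P hx; apply: span_gen; exists [tuple of [:: x]].
  by split=> [i|]; rewrite ?big_ord1 !(tnth_nth 0) ?ord1.
apply: span_min => [|_ [x [y [hx /IH hy ->]]]]; first exact: span_subspace.
apply: (span_linear (f := x \*o idfun)) hy => [|_ [s [hs ->]]].
  exact: span_subspace.
apply: span_gen; exists [tuple of x :: s]; split=> [i|].
  by case: (unliftP ord0 i) => [j|] ->; rewrite (tnth_nth 0) //= -tnth_nth.
rewrite [RHS]big_ord_recl; congr (_ * _); apply: eq_bigr => i _.
by rewrite !(tnth_nth 0).
Qed.

Lemma KinftyE : @Kinfty C A = [set a | forall n, aug_power n a].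
Proof.
apply/seteqP; split=> [x hx [//|n]|x hx n n0].
  by rewrite -Kpow_aug //; exact: hx.
by rewrite Kpow_aug.
Qed.

(** The filtration of A ⊗ A induced by [aug_power]; the comultiplication preserves
    it. *)
Definition aug_tensor n : set (tensor A A) :=
  linear_span [set t | exists i j x y,
    [/\ (n <= i + j)%N, aug_power i x, aug_power j y & t = x ⊗ y]].

Lemma aug_tensor_pure i j x y :
  aug_power i x -> aug_power j y -> aug_tensor (i + j) (x ⊗ y).
Proof. by move=> hx hy; apply: span_gen; exists i, j, x, y. Qed.

Lemma aug_coef n (u : 'M[A]_n) i j : unitary_corepresentation u ->
  aug_power 1 (u i j - (i == j)%:R).
Proof.
by move=> hu; apply/aug1P; rewrite linearB /= counit_coef // rmorph_nat subrr.
Qed.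

Lemma aug_tensor_subspace n : subspace (aug_tensor n).
Proof. exact: span_subspace. Qed.

Lemma tpure_natl n y : (n%:R : A) ⊗ y = (1 : A) ⊗ (n%:R * y).
Proof. by rewrite mulr_natl -scaler_nat -[in RHS]scaler_nat tpureZl tpureZr. Qed.

(** On coefficients,
    \sum_k u i k ⊗ u k j - delta_ij 1 ⊗ 1
      = \sum_k (u i k - delta_ik) ⊗ u k j + 1 ⊗ (u i j - delta_ij). *)
Lemma comul_aug1 a : aug_tensor 1 (comul a - (counit a : C) *: (1 ⊗ 1)).
Proof.
apply: (coef_ind (P :=
  [set a | aug_tensor 1 (comul a - (counit a : C) *: (1 ⊗ 1))])) a.
  have [h0 hl] := aug_tensor_subspace 1.
  split=> [|c x y hx hy] /=; first by rewrite !linear0 scale0r subr0.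
  rewrite !linearP scalerDl -scalerA opprD addrACA -scalerBr; exact: hl.
move=> n u i j hu /=; rewrite comul_coef // counit_coef //.
have -> : \sum_k u i k ⊗ u k j - (i == j)%:R *: (1 ⊗ 1) =
    \sum_k (u i k - (i == k)%:R) ⊗ u k j + 1 ⊗ (u i j - (i == j)%:R).
  under [in RHS]eq_bigr => k _ do rewrite tpureBl tpure_natl.
  rewrite sumrB -tpure_sumr delta_suml tpureBr addrA subrK; congr (_ - _).
  by rewrite -tpureZr scaler_nat.
apply: subspaceD; first exact: aug_tensor_subspace.
  apply: subspace_sum => [|k _]; first exact: aug_tensor_subspace.
  by apply: (aug_tensor_pure (i := 1) (j := 0)) => //; exact: aug_coef.
by apply: (aug_tensor_pure (i := 0) (j := 1)) => //; exact: aug_coef.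
Qed.

Lemma comul_aug n a : aug_power n a -> aug_tensor n (comul a).
Proof.
elim: n a => [|n IH] a.
  move=> _; apply: span_min (tensor_span (comul a)) => [|_ [x [y ->]]].
    exact: aug_tensor_subspace.
  exact: (aug_tensor_pure (i := 0) (j := 0)).
apply: (span_linear (f := @comul C A)) => [|_ [x [y [hx hy ->]]]].
  exact: aug_tensor_subspace.
rewrite comulM; have := comul_aug1 x; rewrite [counit x]hx scale0r subr0 => hx'.
apply: tmul_span hx' (IH _ hy); first exact: aug_tensor_subspace.
move=> _ _ [i [j [p [q [ij hp hq ->]]]]] [k [l [r [s [kl hr hs ->]]]]].
rewrite tmul_pure; apply: span_gen.
exists (i + k)%N, (j + l)%N, (p * r), (q * s); split=> //; try exact: augM.
by rewrite addnACA -add1n leq_add.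
Qed.

(** If i + j >= n + n, then i >= n or j >= n. *)
Lemma aug_tensor_sub n : aug_tensor (n + n) `<=` tensor_sub (aug_power n).
Proof.
apply: spanS => _ [i [j [x [y [ij hx hy ->]]]]]; exists x, y; split=> //.
have [ni|ni] := leqP n i; first by left; exact: aug_le hx.
right; apply: aug_le hy; rewrite leqNgt; apply/negP => jn.
by have := leq_trans (leq_add ni (ltnW jn)) ij; rewrite addSn ltnn.
Qed.

Lemma Kinfty_hopf_star_ideal : hopf_star_ideal (@Kinfty C A).
Proof.
rewrite KinftyE; split.
- split.
  + by move=> n; exact: (aug_subspace n).1.
  + by move=> c x y hx hy n; apply: (aug_subspace n).2.
  + by move=> a x hx n; exact: aug_mull.
  + by move=> a x hx n; exact: aug_mulr.
- by move=> x hx n; exact: aug_star.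
- move=> x hx; apply: tensor_sub_bigcap => [n|m n|n]; first exact: aug_subspace.
    exact: aug_le.
  by apply/aug_tensor_sub/comul_aug.
- by move=> x hx; apply/aug1P.
- by move=> x hx n; exact: aug_antipode.
Qed.

(** The antipode is -1 on K_1 / K_2: with y = u - 1, unitarity reads
    y + y^* = - y y^*, whose entries lie in K_2. *)
Lemma antipode_aug2 a : aug_power 2 (antipode a + a - (counit a : C) *: 2%:R).
Proof.
have [h0 hl] := aug_subspace 2.
apply: (coef_ind
  (P := [set a | aug_power 2 (antipode a + a - (counit a : C) *: 2%:R)])) a.
  split=> [|c x y hx hy] /=; first by rewrite !linear0 scale0r subr0 addr0.
  rewrite !linearP scalerDl -scalerA addrACA -scalerDr opprD addrACA -scalerBr.
  exact: hl.
move=> n u i j hu /=; rewrite antipode_coef // counit_coef //.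
have -> : star (u j i) + u i j - (i == j)%:R *: 2%:R =
    - \sum_k (u i k - (i == k)%:R) * star (u j k - (k == j)%:R).
  under eq_bigr => k _ do rewrite starB star_nat mulrBl !mulrBr.
  rewrite !sumrB unitary_right // !delta_sum delta_suml.
  rewrite -[2%:R]/(1 + 1) scalerDr scaler_nat !opprB opprD.
  by rewrite !addrA; congr (_ - _); rewrite addrAC.
apply: subspaceN => //; apply: subspace_sum => // k _.
apply: (augM (m := 1) (n := 1)); first exact: aug_coef.
by apply: aug_star; rewrite eq_sym; exact: aug_coef.
Qed.

(** Subtract the congruences of [antipode_aug2] at antipode a and at a. *)
Lemma sqantipode_aug2 a : aug_power 2 (sqantipode A a - a).
Proof.
have := subspaceB (aug_subspace 2) (antipode_aug2 (antipode a)) (antipode_aug2 a).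
rewrite [counit (antipode a)]counit_antipode opprB addrA subrK.
by rewrite opprD addrA addrK.
Qed.

(** Since D = sqantipode is multiplicative,
    D(xy) - xy = (Dx - x) Dy + x (Dy - y), and Dx - x is in K_2 for every x. *)
Lemma sqantipode_aug n a : aug_power n a -> aug_power n.+1 (sqantipode A a - a).
Proof.
elim: n a => [|n IH] a; first by move=> _; exact/augS/sqantipode_aug2.
pose f : {linear A -> A} := sqantipode A \- idfun.
apply: (span_linear (f := f)); first exact: aug_subspace.
move=> _ [x [y [hx hy ->]]].
rewrite -[f _]/(sqantipode A (x * y) - x * y) sqantipodeM.
have -> : sqantipode A x * sqantipode A y - x * y =
    (sqantipode A x - x) * sqantipode A y + x * (sqantipode A y - y).
  by rewrite mulrBl mulrBr addrA subrK.
apply: subspaceD; first exact: aug_subspace.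
  apply: (augM (m := 2) (sqantipode_aug2 x)).
  exact: (aug_antipode (aug_antipode hy)).
by apply: aug_mulkerl => //; exact: IH.
Qed.

End AugmentationFiltration.

(** * Coefficients of direct sums of unitary corepresentations *)

Section DirectSums.
Variables (C : numClosedFieldType) (A : cqgAlgType C).

Definition coefspan n (u : 'M[A]_n) : set A :=
  linear_span [set a | exists i j, a = u i j].

Definition dsum m n (u : 'M[A]_m) (v : 'M[A]_n) : 'M[A]_(m + n) := block_mx u 0 0 v.

Lemma dsum_unitary m n (u : 'M[A]_m) (v : 'M[A]_n) :
  unitary_corepresentation u -> unitary_corepresentation v ->
  unitary_corepresentation (dsum u v).
Proof.
move=> hu hv; have [_ u1 u2] := hu; have [_ v1 v2] := hv.
have adj : adjoint_mx (dsum u v) = dsum (adjoint_mx u) (adjoint_mx v).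
  have adjE k (M : 'M[A]_k) : adjoint_mx M = (map_mx star M)^T.
    by apply/matrixP=> i j; rewrite !mxE.
  rewrite !adjE /dsum map_block_mx tr_block_mx.
  by congr block_mx; apply/matrixP=> i j; rewrite !mxE star0.
split; last 2 first.
- by rewrite adj mulmx_block !mulmx0 !mul0mx !addr0 !add0r u1 v1 -scalar_mx_block.
- by rewrite adj mulmx_block !mulmx0 !mul0mx !addr0 !add0r u2 v2 -scalar_mx_block.
have t0l (x : A) : (0 : A) ⊗ x = 0 by exact: tpure0l.
have t0r (x : A) : x ⊗ (0 : A) = 0 by exact: tpure0r.
move=> i j; rewrite big_split_ord /=.
case: (split_ordP i) => k ->; case: (split_ordP j) => l ->.
- under eq_bigr => p _ do rewrite !block_mxEul.
  rewrite [X in _ + X]big1 ?addr0 => [|p _]; last by rewrite block_mxEur mxE t0l.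
  by rewrite block_mxEul comul_coef // counit_coef // eq_lshift.
- rewrite !big1 ?addr0 => [|p _|p _].
  + by rewrite block_mxEur mxE !linear0 eq_lrshift.
  + by rewrite block_mxEur mxE t0l.
  + by rewrite [X in _ ⊗ X]block_mxEur [X in _ ⊗ X]mxE t0r.
- rewrite !big1 ?addr0 => [|p _|p _].
  + by rewrite block_mxEdl mxE !linear0 eq_rlshift.
  + by rewrite [X in _ ⊗ X]block_mxEdl [X in _ ⊗ X]mxE t0r.
  + by rewrite block_mxEdl mxE t0l.
- under [X in _ + X]eq_bigr => p _ do rewrite !block_mxEdr.
  rewrite [X in X + _]big1 ?add0r => [|p _]; last by rewrite block_mxEdl mxE t0l.
  by rewrite block_mxEdr comul_coef // counit_coef // eq_rshift.
Qed.

Lemma coefspan_dsuml m n (u : 'M[A]_m) (v : 'M[A]_n) :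
  coefspan u `<=` coefspan (dsum u v).
Proof.
apply: spanS => _ [i [j ->]]; exists (lshift n i), (lshift n j).
by rewrite block_mxEul.
Qed.

Lemma coefspan_dsumr m n (u : 'M[A]_m) (v : 'M[A]_n) :
  coefspan v `<=` coefspan (dsum u v).
Proof.
apply: spanS => _ [i [j ->]]; exists (rshift m i), (rshift m j).
by rewrite block_mxEdr.
Qed.

(** Direct sums make the set of all such elements a subspace. *)
Lemma coefspan_exists (a : A) :
  exists n (w : 'M[A]_n), unitary_corepresentation w /\ coefspan w a.
Proof.
apply: (coef_ind (P := [set a | exists n (w : 'M[A]_n),
  unitary_corepresentation w /\ coefspan w a])) a => [|n u i j hu]; last first.
  by exists n, u; split=> //; apply: span_gen; exists i, j.
split=> [|c x y [m [u [hu hx]]] [n [v [hv hy]]]] /=.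
  exists 1%N, 1%:M; split; first exact: unitary1.
  exact: (span_subspace _).1.
exists (m + n)%N, (dsum u v); split; first exact: dsum_unitary.
apply: (span_subspace _).2; first exact: coefspan_dsuml hx.
exact: coefspan_dsumr hy.
Qed.

Lemma coefspan_seq (s : seq A) :
  exists n (w : 'M[A]_n), unitary_corepresentation w /\
    forall a, a \in s -> coefspan w a.
Proof.
elim: s => [|a s [n [w [hw hs]]]].
  by exists 1%N, 1%:M; split=> //; exact: unitary1.
have [m [u [hu ha]]] := coefspan_exists a.
exists (m + n)%N, (dsum u w); split; first exact: dsum_unitary.
move=> b; rewrite inE => /orP[/eqP ->|/hs]; first exact: coefspan_dsuml ha.
exact: coefspan_dsumr.
Qed.

Lemma coefspanP n (w : 'M[A]_n) a : coefspan w a ->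
  exists c : 'M[C]_n, a = \sum_i \sum_j c i j *: w i j.
Proof.
apply: (span_min
  (V := [set a | exists c : 'M[C]_n, a = \sum_i \sum_j c i j *: w i j])).
  split=> [|k x y [c ->] [d ->]] /=.
    exists 0; rewrite big1 // => i _; rewrite big1 // => j _.
    by rewrite mxE scale0r.
  exists (k *: c + d); rewrite scaler_sumr -big_split; apply: eq_bigr => i _ /=.
  rewrite scaler_sumr -big_split; apply: eq_bigr => j _ /=.
  by rewrite !mxE scalerDl scalerA.
move=> _ [i [j ->]] /=; exists (delta_mx i j).
rewrite (bigD1 i) //= (bigD1 j) //= !big1 ?addr0 => [|k /negPf ki|k /negPf kj].
- by rewrite mxE !eqxx scale1r.
- by rewrite big1 // => l _; rewrite mxE ki scale0r.
- by rewrite mxE kj andbF scale0r.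
Qed.

End DirectSums.

(** * The squared antipode is a conjugation on each unitary corepresentation *)

Section ConjugateRepresentation.
Variables (C : numClosedFieldType) (A : cqgAlgType C).
Implicit Types f g : {scalar A}.

Lemma convolution_bilinear f g :
  bilinear_for *:%R *:%R (fun x y : A => f x * g y : C^o).
Proof.
split=> [y|x] k p q /=; rewrite linearP /=.
  by rewrite mulrDl -mulrA.
by rewrite mulrDr mulrCA.
Qed.

(** The product dual to the comultiplication; evaluation on a corepresentation
    turns it into the product of matrices. *)
Definition convolution f g : {scalar A} :=
  mk_scalar (f := fun a => tlin (convolution_bilinear f g) (comul a))
    (fun k x y => etrans (congr1 _ (linearP _ _ _ _)) (linearP _ _ _ _)).

Lemma convolutionE f g a I (r : seq I) (x y : I -> A) :
  comul a = \sum_(i <- r) x i ⊗ y i ->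
  convolution f g a = \sum_(i <- r) f (x i) * g (y i).
Proof.
move=> ha; rewrite -[LHS]/(tlin (convolution_bilinear f g) (comul a)) ha linear_sum.
by apply: eq_bigr => i _; exact: (tlin_pure (convolution_bilinear f g)).
Qed.

Definition counit_functional : {scalar A} :=
  mk_scalar (f := fun a => counit a : C) (fun k x y => linearP _ k x y).

Lemma conj_star_scalar f : scalar (fun a => (f (star a))^*).
Proof.
by move=> k x y; rewrite star_conjlinear linearP /= rmorphD rmorphM /= conjCK.
Qed.

Definition conj_star f : {scalar A} := mk_scalar (conj_star_scalar f).

Lemma involution_scalar f : scalar (fun a => (f (star (antipode a)))^*).
Proof.
move=> k x y.
by rewrite linearP star_conjlinear linearP /= rmorphD rmorphM /= conjCK.
Qed.

(** The involution dual to a |-> star (antipode a); evaluation on a unitary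
    corepresentation turns it into the adjoint of matrices. *)
Definition involution f : {scalar A} := mk_scalar (involution_scalar f).

Lemma zero_scalar : scalar ((fun=> 0) : A -> C).
Proof. by move=> k x y; rewrite mulr0 addr0. Qed.

Lemma comb_scalar c f g : scalar (fun a => c * f a + g a).
Proof. by move=> k x y; rewrite !linearP /=; ring. Qed.

(** The matrices f(w) form a star-algebra, for a unitary w whose coefficients span
    all star (u i j), and f(w) |-> f(star u) is a representation of it.  The form
    given by [representation_form] relates f(star u) to f(star (D u)), where
    D = sqantipode, because star (antipode (star (u j i))) = star (D (u i j)).
    Taking f = conj_star g and conjugating all entries leaves the relation for u
    itself. *)
Lemma sqantipode_conjugation n (u : 'M[A]_n) : unitary_corepresentation u ->
  exists Q : 'M[C]_n, [/\ Q \in unitmx, ctrmx Q = Q &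
    forall f, map_mx f (map_mx (sqantipode A) u) *m Q = Q *m map_mx f u].
Proof.
move=> hu.
have [m [w [hw hs]]] := coefspan_seq [seq star (u p.1 p.2) | p : 'I_n * 'I_n].
have hc (p : 'I_n * 'I_n) : exists c : 'M[C]_m,
    star (u p.1 p.2) = \sum_i \sum_j c i j *: w i j.
  by apply/coefspanP/hs; apply/mapP; exists p; rewrite ?mem_enum.
pose c p := projT1 (cid (hc p)).
have cP i j : star (u i j) = \sum_k \sum_l c (i, j) k l *: w k l.
  by rewrite /c; case: (cid _).
pose rho0 (M : 'M[C]_m) : 'M[C]_n :=
  \matrix_(i, j) \sum_k \sum_l c (i, j) k l * M k l.
have rho_lin : linear rho0.
  move=> k M N; apply/matrixP => i j; rewrite !mxE mulr_sumr -big_split.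
  apply: eq_bigr => p _; rewrite mulr_sumr -big_split; apply: eq_bigr => q _ /=.
  by rewrite !mxE; ring.
pose rho : {linear 'M[C]_m -> 'M[C]_n} :=
  HB.pack rho0 (GRing.isLinear.Build _ _ _ _ rho0 rho_lin).
have rhoE f : rho (map_mx f w) = \matrix_(i, j) f (star (u i j)).
  apply/matrixP => i j; rewrite !mxE cP linear_sum; apply: eq_bigr => k _.
  by rewrite linear_sum; apply: eq_bigr => l _; rewrite !mxE scalarZ.
pose P : set 'M[C]_m := [set M | exists f, M = map_mx f w].
have convw f g : map_mx f w *m map_mx g w = map_mx (convolution f g) w.
  apply/matrixP => i j; rewrite !mxE (convolutionE _ _ (comul_coef hw i j)).
  by apply: eq_bigr => k _; rewrite !mxE.
have invw f : ctrmx (map_mx f w) = map_mx (involution f) w.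
  by apply/matrixP => i j; rewrite !mxE /= antipode_coef // starK.
have onew : 1%:M = map_mx counit_functional w.
  by apply/matrixP => i j; rewrite !mxE /= counit_coef.
have [||||||Q [Qu Qh QP]] := @representation_form C m n P rho.
- split.
    by exists (mk_scalar zero_scalar); apply/matrixP=> i j; rewrite !mxE.
  move=> k _ _ [f ->] [g ->]; exists (mk_scalar (comb_scalar k f g)).
  by apply/matrixP=> i j; rewrite !mxE.
- by exists counit_functional.
- by move=> _ _ [f ->] [g ->]; exists (convolution f g).
- by move=> _ [f ->]; exists (involution f).
- rewrite onew rhoE; apply/matrixP=> i j; rewrite !mxE /=.
  by rewrite counit_star_coef.
- move=> _ _ [f ->] [g ->]; rewrite convw !rhoE; apply/matrixP=> i j; rewrite !mxE.
  have hD : comul (star (u i j)) = \sum_k star (u i k) ⊗ star (u k j).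
    by rewrite comul_star comul_coef // tstar_sum.
  by rewrite (convolutionE _ _ hD); apply: eq_bigr => k _; rewrite !mxE.
exists (map_mx Num.conj Q); split.
- by rewrite map_unitmx.
- by rewrite -[in RHS]Qh; apply/matrixP=> i j; rewrite !mxE.
move=> g; have := QP _ (ex_intro _ (conj_star g) erefl).
rewrite invw !rhoE => /(congr1 (map_mx Num.conj)); rewrite !map_mxM => e.
have -> : map_mx g u = map_mx Num.conj (\matrix_(i, j) conj_star g (star (u i j))).
  by apply/matrixP=> i j; rewrite !mxE /= starK conjCK.
rewrite e; congr (_ *m _); apply/matrixP=> i j.
by rewrite !mxE /= !conjCK starK antipode_coef.
Qed.

End ConjugateRepresentation.

(** * The squared antipode modulo the intersection of the powers *)

Section SquaredAntipode.
Variables (C : numClosedFieldType) (A : cqgAlgType C).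

Definition sqantipode_diff : {linear A -> A} := sqantipode A \- idfun.

Lemma diff_scalar (g : {scalar A}) : scalar (fun a => g (sqantipode_diff a)).
Proof. by move=> k x y; rewrite !linearP. Qed.

(** The powers of D - 1, with D = sqantipode, act on functionals by pullback
    because [sqantipode_conjugation] applies to one functional at a time. *)
Fixpoint diff_iter (g : {scalar A}) k : {scalar A} :=
  if k is l.+1 then mk_scalar (diff_scalar (diff_iter g l)) else g.

Lemma diff_iter_vanish n (g : {scalar A}) k m a :
  (forall x, aug_power n x -> g x = 0) -> (n <= m + k)%N ->
  aug_power m a -> diff_iter g k a = 0.
Proof.
move=> hg; elim: k m a => [|k IH] m a nm ha.
  by apply/hg/(aug_le _ ha); rewrite -[m]addn0.
by apply: (IH m.+1); [rewrite addSnnS|exact: sqantipode_aug].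
Qed.

(** If an entry of D u - u were outside K_n, some functional g that vanishes on
    K_n would detect it.  But the matrices X k = g((D - 1)^k u) satisfy
    X k.+1 = Q (X k) Q^-1 - X k and X n.+1 = 0, so X 1 = 0. *)
Lemma sqantipode_Kinfty a : Kinfty (sqantipode A a - a).
Proof.
rewrite KinftyE => n; have hV := aug_subspace A n.
apply: (coef_ind (P := [set a | aug_power n (sqantipode A a - a)])) a.
  split=> [|c x y hx hy] /=.
    by rewrite -[X in aug_power n X]/(sqantipode_diff 0) linear0; exact: hV.1.
  rewrite -[X in aug_power n X]/(sqantipode_diff (c *: x + y)) linearP.
  exact: hV.2.
move=> d u i j hu; apply: contrapT => /= /(separating_functional hV)[g [g1 g0]].
have [Q [Qu Qh hQ]] := sqantipode_conjugation hu.
have : map_mx (diff_iter g 1) u = 0.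
  apply: (hermitian_conj_unipotent (k := n)
    (X := fun k => map_mx (diff_iter g k) u) Qu Qh) => [k|].
    rewrite -hQ -mulmxBl; congr (_ *m _); apply/matrixP=> p q; rewrite !mxE.
    exact: linearB.
  apply/matrixP=> p q; rewrite !mxE.
  exact: (diff_iter_vanish (n := n) (m := 0)).
move=> /matrixP/(_ i j); rewrite !mxE => h; have := g1; rewrite [LHS]h => /eqP.
by rewrite eq_sym oner_eq0.
Qed.

End SquaredAntipode.

(** * Existence of the three quantum subgroups *)

Section Existence.
Variables (C : numClosedFieldType) (A : cqgAlgType C).

Lemma hopf_star_ideal_subspace (I : set A) : hopf_star_ideal I -> subspace I.
Proof. by case=> [[I0 Il _ _] _ _ _ _]; split. Qed.

Lemma span_hopf_star_ideal (F : set (set A)) :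
  (forall I, F I -> hopf_star_ideal I) ->
  hopf_star_ideal (linear_span [set x | exists I, F I /\ I x]).
Proof.
move=> hF; set J := linear_span _; have hJ : subspace J by exact: span_subspace.
have sub I : F I -> I `<=` J by move=> FI x Ix; apply: span_gen; exists I.
split.
- split; [exact: hJ.1|exact: hJ.2|move=> a|move=> a].
    apply: (span_linear (f := a \*o idfun)) => // x [I [FI Ix]] /=.
    by apply: (sub I) => //; apply: (tsi_mull (hsi_ideal (hF _ FI))).
  apply: (span_linear (f := mulr_lin a)) => // x [I [FI Ix]] /=.
  by apply: (sub I) => //; apply: (tsi_mulr (hsi_ideal (hF _ FI))).
- apply: span_star => // x [I [FI Ix]]; apply: (sub I) => //.
  exact: (hsi_star (hF _ FI)).
- apply: (span_linear (f := @comul C A)); first exact: span_subspace.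
  move=> x [I [FI Ix]]; apply: (tensor_subS (sub I FI)).
  exact: (hsi_comul (hF _ FI)).
- apply: (span_min (counit_ker_subspace A)) => x [I [FI Ix]].
  exact: (hsi_counit (hF _ FI)).
- apply: (span_linear (f := @antipode C A)) => // x [I [FI Ix]].
  by apply: (sub I) => //; exact: (hsi_antipode (hF _ FI)).
Qed.

Lemma Gauss_spec : qideal (Gauss A) `<=` @gaussian_kernel C A /\
  forall I, hopf_star_ideal I -> I `<=` @gaussian_kernel C A ->
    I `<=` qideal (Gauss A).
Proof.
apply: (@xgetPex _ _ [set H | qideal H `<=` @gaussian_kernel C A /\ forall I,
  hopf_star_ideal I -> I `<=` @gaussian_kernel C A -> I `<=` qideal H]).
pose F : set (set A) := [set I | hopf_star_ideal I /\ I `<=` @gaussian_kernel C A].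
have hF I : F I -> hopf_star_ideal I by case.
exists (QuantumSubgroup (span_hopf_star_ideal hF)); split=> /=.
  apply: span_min => [|x [I [[_ h] /h //]]].
  split=> [phi _|c x y hx hy phi hphi]; first exact: linear0.
  by rewrite linearP hx // hy // addr0 [LHS]mulr0.
by move=> I hI Igk x Ix; apply: span_gen; exists I.
Qed.

Lemma G00_spec : qideal (G00 A) = @Kinfty C A.
Proof.
apply: (@xgetPex _ _ [set H | qideal H = @Kinfty C A]).
by exists (QuantumSubgroup (Kinfty_hopf_star_ideal A)).
Qed.

(** The Hopf star-ideal of the Kac part is the two-sided ideal that forces the
    square of the antipode to be the identity. *)
Definition kac_ideal : set A :=
  linear_span [set z | exists x a y, z = x * (sqantipode A a - a) * y].

Lemma kac_ideal_gen a : kac_ideal (sqantipode A a - a).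
Proof. by apply: span_gen; exists 1, a, 1; rewrite mul1r mulr1. Qed.

(** I ⊗ A + A ⊗ I is a two-sided ideal when I is one. *)
Lemma tensor_sub_tmul (I : set A) s t :
  (forall a x, I x -> I (a * x) /\ I (x * a)) ->
  tensor_sub I t -> tensor_sub I (tmul s t) /\ tensor_sub I (tmul t s).
Proof.
move=> hI ht; split.
  apply: tmul_span (tensor_span s) ht; first exact: span_subspace.
  move=> _ _ [a [b ->]] [x [y [hxy ->]]]; rewrite tmul_pure; apply: span_gen.
  exists (a * x), (b * y); split=> //.
  by case: hxy => [h|h]; [left; case: (hI a x h)|right; case: (hI b y h)].
apply: tmul_span ht (tensor_span s); first exact: span_subspace.
move=> _ _ [x [y [hxy ->]]] [a [b ->]]; rewrite tmul_pure; apply: span_gen.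
exists (x * a), (y * b); split=> //.
by case: hxy => [h|h]; [left; case: (hI a x h)|right; case: (hI b y h)].
Qed.

(** With D = sqantipode, each axiom is checked on the generators D a - a:
    the star of D a - a is - (D b - b) for b = star (D a), since
    D (star (D a)) = star a; the comultiplication commutes with D; and the
    antipode sends D a - a to D (antipode a) - antipode a. *)
Lemma kac_ideal_hopf_star : hopf_star_ideal kac_ideal.
Proof.
have hJ : subspace kac_ideal by exact: span_subspace.
have hl a x : kac_ideal x -> kac_ideal (a * x).
  apply: (span_linear (f := a \*o idfun)) => // _ [y [b [z ->]]] /=.
  by apply: span_gen; exists (a * y), b, z; rewrite !mulrA.
have hr a x : kac_ideal x -> kac_ideal (x * a).
  apply: (span_linear (f := mulr_lin a)) => // _ [y [b [z ->]]] /=.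
  by apply: span_gen; exists y, b, (z * a); rewrite !mulrA.
split.
- by split=> //; [exact: hJ.1|exact: hJ.2].
- apply: span_star => // _ [x [a [y ->]]]; rewrite !starM; apply/hl/hr.
  have SsS z : antipode (star (antipode z)) = star z :> A.
    by rewrite -[LHS]starK star_antipodeK.
  have -> : star (sqantipode A a - a) =
      - (sqantipode A (star (sqantipode A a)) - star (sqantipode A a)).
    by rewrite /= !SsS opprB starB.
  by apply: subspaceN => //; exact: kac_ideal_gen.
- apply: (span_linear (f := @comul C A)); first exact: span_subspace.
  move=> _ [x [a [y ->]]]; rewrite !comulM.
  apply: (tensor_sub_tmul _ _ _).2; first by split; [exact: hl|exact: hr].
  apply: (tensor_sub_tmul _ _ _).1; first by split; [exact: hl|exact: hr].
  have [s hs] := tensor_sum (comul a).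
  rewrite linearB (comul_sqantipode hs) hs -sumrB.
  apply: subspace_sum => [|p _]; first exact: span_subspace.
  have -> : sqantipode A p.1 ⊗ sqantipode A p.2 - p.1 ⊗ p.2 =
      (sqantipode A p.1 - p.1) ⊗ sqantipode A p.2 +
      p.1 ⊗ (sqantipode A p.2 - p.2).
    by rewrite tpureBl tpureBr addrA subrK.
  apply: subspaceD; first exact: span_subspace.
    apply: span_gen; eexists _, _; split; last by [].
    by left; exact: kac_ideal_gen.
  apply: span_gen; eexists _, _; split; last by [].
  by right; exact: kac_ideal_gen.
- apply: (span_min (counit_ker_subspace A)) => _ [x [a [y ->]]].
  have /aug1P h0 := augS (sqantipode_aug2 a).
  by rewrite /= !rmorphM /= [counit (_ - _)]h0 mulr0 mul0r.
- apply: (span_linear (f := @antipode C A)) => // _ [x [a [y ->]]].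
  rewrite !antipodeM; apply/hl/hr.
  have -> : antipode (sqantipode A a - a) = sqantipode A (antipode a) - antipode a.
    exact: linearB.
  exact: kac_ideal_gen.
Qed.

Lemma Kac_spec : is_largest_subgroup (@kac_type C A) (Kac A).
Proof.
apply: (@xgetPex _ _ (is_largest_subgroup (@kac_type C A))).
exists (QuantumSubgroup kac_ideal_hopf_star); split.
  by apply/kac_typeP => a; exact: kac_ideal_gen.
move=> H /kac_typeP hH; apply: span_min => [|_ [x [a [y ->]]]].
  exact/hopf_star_ideal_subspace/qidealP.
by apply/(tsi_mulr (hsi_ideal (qidealP H)))/(tsi_mull (hsi_ideal (qidealP H)))/hH.
Qed.

End Existence.

Theorem theoremA (R : realType) (A : cqgAlgType R[i]) :
  qsubset (Gauss A) (G00 A) /\ qsubset (G00 A) (Kac A).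
Proof.
split.
  have [_ maxG] := Gauss_spec A; rewrite /qsubset G00_spec; apply: maxG.
    exact: Kinfty_hopf_star_ideal.
  by move=> a ha phi [_ h]; apply/h/ha.
apply: (Kac_spec A).2; apply/kac_typeP => a; rewrite G00_spec.
exact: sqantipode_Kinfty.
Qed.
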